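(* Let $n\ge 2$. For $1\le j\le n$ let $\Gamma_j:U_j\to\mathbb{R}^n$, with $U_j\subseteq\mathbb{R}^{n-1}$ bounded, be smooth parametrisations of compact hypersurfaces $S_j$ in $\mathbb{R}^n$ with nonvanishing gaussian curvature, and suppose the hypersurfaces are transversal, with extension operators $\mathcal{E}_j$. Then the multilinear restriction bound $$\Big\|\prod_{j=1}^n|\mathcal{E}_jf_j|^{1/n}\Big\|_{L^{2n/(n-1)}(\mathbb{R}^n)}\lesssim\prod_{j=1}^n\|f_j\|_{L^2(U_j)}^{1/n}\quad\text{for all } f_j\in L^2(U_j)$$ holds if and only if for all nonnegative $G\in L^n(\mathbb{R}^n)$ there exist nonnegative measurable functions $g_1,\dots,g_n$ on $\mathbb{R}^n$ such that $$\prod_{j=1}^n g_j(x)^{1/n}\ge G(x)\quad\text{for a.e. }x\in\mathbb{R}^n,$$ and, for all $j$, $$\left(\int_{\mathbb{R}^n}|\mathcal{E}_jf_j(x)|^2g_j(x)\,\mathrm{d}x\right)^{1/2}\lesssim\|G\|_{L^n(\mathbb{R}^n)}^{1/2}\|f_j\|_{L^2(U_j)}\quad\text{for all } f_j\in L^2(U_j).$$ Here $\lesssim$ means that the inequality holds with some finite constant independent of the functions $f_j$ and $G$.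
   Context: Transversality: if $\omega_j(x)$ denotes a unit normal to $S_j$ at $x\in S_j$, there is $c>0$ with $|\omega_1(x_1)\wedge\dots\wedge\omega_n(x_n)|\ge c$ for all $x_j\in S_j$. The Fourier extension operator for $S_j$ is $$\mathcal{E}_jf_j(x)=\int_{U_j}e^{2\pi i x\cdot\Gamma_j(t)}f_j(t)\,\mathrm{d}t,\qquad x\in\mathbb{R}^n.$$ *)

(* Defs.v *)
From HB Require Import structures.
From mathcomp Require Import all_boot all_order all_algebra.
From mathcomp Require Import all_classical all_reals all_analysis.
From mathcomp Require Import complex.

Set Implicit Arguments.
Unset Strict Implicit.
Unset Printing Implicit Defensive.

Import Order.TTheory GRing.Theory Num.Theory.
Import numFieldNormedType.Exports.

Local Open Scope classical_set_scope.
Local Open Scope ring_scope.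

(* The Borel sigma-algebra of 'rV[R]_n, generated by the coordinates exactly as
   the library does for n.-tuple R. *)
Section borel_rV.
Variables (R : realType) (n : nat).

Let coord (i : 'I_n) (x : 'rV[R]_n) : measurableTypeR R := x ord0 i.

Let rV_set0 : g_sigma_preimage coord set0.
Proof. exact: sigma_algebra0. Qed.

Let rV_setC A : g_sigma_preimage coord A -> g_sigma_preimage coord (~` A).
Proof. exact: sigma_algebraC. Qed.

Let rV_bigcup (F : (set 'rV[R]_n)^nat) :
  (forall i, g_sigma_preimage coord (F i)) ->
  g_sigma_preimage coord (\bigcup_i (F i)).
Proof. exact: sigma_algebra_bigcup. Qed.

HB.instance Definition _ := @isMeasurable.Build default_measure_display
  'rV[R]_n (g_sigma_preimage coord) rV_set0 rV_setC rV_bigcup.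

Lemma measurable_rV_coord (i : 'I_n) :
  measurable_fun [set: 'rV[R]_n] (fun x => x ord0 i : measurableTypeR R).
Proof.
move=> _ Y mY; rewrite setTI; apply: sub_sigma_algebra => /=.
rewrite -bigcup_seq/=; exists i => /=; first by rewrite mem_index_enum.
by exists Y => //; rewrite setTI.
Qed.

Lemma measurable_to_rV d (T : measurableType d) (f : T -> 'rV[R]_n) :
  (forall i, measurable_fun [set: T]
     (fun t => f t ord0 i : measurableTypeR R)) ->
  measurable_fun [set: T] f.
Proof.
move=> mf _ A mA; rewrite setTI.
suff : g_sigma_preimage coord `<=` [set A | measurable (f @^-1` A)] by exact.
apply: smallest_sub => [|B].
  split => /=; first by rewrite preimage_set0.
  - by move=> B mB; rewrite setTD preimage_setC; exact: measurableC.
  - by move=> F mF; rewrite preimage_bigcup; exact: bigcup_measurable.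
rewrite -bigcup_seq/= => -[i _ [Y mY <-]]; rewrite setTI /=.
by have := mf i measurableT Y mY; rewrite setTI.
Qed.

End borel_rV.

(* Lebesgue measure on R^n as an iterated product, using R^n.+1 = R x R^n. *)
Section lebesgue_rV.
Variable R : realType.

Definition rV_cons n (p : measurableTypeR R * 'rV[R]_n) : 'rV[R]_n.+1 :=
  \row_i (if unlift ord0 i is Some k then p.2 ord0 k else p.1).

Definition rV_uncons n (x : 'rV[R]_n.+1) : measurableTypeR R * 'rV[R]_n :=
  (x ord0 ord0, \row_i x ord0 (lift ord0 i)).

Lemma rV_consK n : cancel (@rV_cons n) (@rV_uncons n).
Proof.
move=> [a v]; rewrite /rV_uncons !mxE unlift_none /=; congr pair.
by apply/rowP => i; rewrite !mxE liftK.
Qed.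

Lemma rV_unconsK n : cancel (@rV_uncons n) (@rV_cons n).
Proof.
move=> x; apply/rowP => i; rewrite !mxE.
by case: unliftP => [k ->|->]; rewrite /= ?mxE.
Qed.

Lemma measurable_rV_cons n : measurable_fun setT (@rV_cons n).
Proof.
apply: measurable_to_rV => i; case: (unliftP ord0 i) => [k ->|->].
- rewrite (_ : (fun _ => _) =
    (fun x : 'rV[R]_n => x ord0 k : measurableTypeR R) \o snd); last first.
    by apply/funext => p /=; rewrite mxE liftK.
  by apply: measurableT_comp => //; exact: measurable_rV_coord.
- rewrite (_ : (fun _ => _) = fst); last first.
    by apply/funext => p /=; rewrite mxE unlift_none.
  exact: measurable_fst.
Qed.

Lemma measurable_rV_uncons n : measurable_fun setT (@rV_uncons n).
Proof.
apply/measurable_fun_pairP; split; first exact: measurable_rV_coord.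
apply: measurable_to_rV => i.
rewrite (_ : (fun _ => _) = fun x : 'rV[R]_n.+1 => x ord0 (lift ord0 i)).
  exact: measurable_rV_coord.
by apply/funext => x /=; rewrite mxE.
Qed.

Section step.
Variables (n : nat) (mu : {sigma_finite_measure set 'rV[R]_n -> \bar R}).

Definition lebesgue_step : set 'rV[R]_n.+1 -> \bar R :=
  pushforward (lebesgue_measure \x mu)%E (@rV_cons n).

Let lebesgue_step0 : lebesgue_step set0 = 0%E.
Proof. by rewrite /lebesgue_step /pushforward preimage_set0 measure0. Qed.

Let lebesgue_step_ge0 A : (0 <= lebesgue_step A)%E.
Proof. by apply: integral_ge0 => // x _; exact: measure_ge0. Qed.

Let measurable_rV_consI (A : set 'rV[R]_n.+1) :
  measurable A -> measurable (@rV_cons n @^-1` A).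
Proof.
by move=> mA; have := measurable_rV_cons measurableT mA; rewrite setTI.
Qed.

Let lebesgue_step_sigma_additive : semi_sigma_additive lebesgue_step.
Proof.
move=> F mF tF mUF; rewrite /lebesgue_step /pushforward preimage_bigcup.
apply: measure_semi_sigma_additive.
- by move=> k; exact: measurable_rV_consI.
- apply/trivIsetP => /= i j _ _ ij; rewrite -preimage_setI.
  by move/trivIsetP : tF => /(_ _ _ _ _ ij) ->//; rewrite preimage_set0.
- by rewrite -preimage_bigcup; exact: measurable_rV_consI.
Qed.

HB.instance Definition _ := isMeasure.Build _ _ _ lebesgue_step
  lebesgue_step0 lebesgue_step_ge0 lebesgue_step_sigma_additive.

Lemma lebesgue_step_sigma_finite : sigma_finite setT lebesgue_step.
Proof.
have /sigma_finiteP[F [TF ndF Foo]] := sigma_finiteT (@lebesgue_measure R).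
have /sigma_finiteP[G [TG ndG Goo]] := sigma_finiteT mu.
exists (fun k => @rV_uncons n @^-1` (F k `*` G k)).
  rewrite -preimage_bigcup (_ : \bigcup_k _ = setT) ?preimage_setT//.
  apply/seteqP; split => // -[a v] _.
  have [k _ Fka] : (\bigcup_k F k) a by rewrite -TF.
  have [l _ Glv] : (\bigcup_k G k) v by rewrite -TG.
  exists (maxn k l) => //; split => /=.
  - by move: Fka; exact/subsetPset/ndF/leq_maxl.
  - by move: Glv; exact/subsetPset/ndG/leq_maxr.
move=> k; have [mF Fk] := Foo k; have [mG Gk] := Goo k.
have mFG : measurable (F k `*` G k) by exact: measurableX.
split; first by have := measurable_rV_uncons measurableT mFG; rewrite setTI.
rewrite /lebesgue_step /pushforward -comp_preimage.
rewrite (_ : _ \o _ = id); last by apply/funext => p /=; rewrite rV_consK.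
by rewrite preimage_id product_measure1E// lte_mul_pinfty// ge0_fin_numE.
Qed.

HB.instance Definition _ := Measure_isSigmaFinite.Build _ _ _ lebesgue_step
  lebesgue_step_sigma_finite.

End step.

Fixpoint lebesgue_rV n : {sigma_finite_measure set 'rV[R]_n -> \bar R} :=
  if n is k.+1 then lebesgue_step (lebesgue_rV k) else \d_(0 : 'rV[R]_0).

End lebesgue_rV.

Lemma measurable_rV_box (R : realType) n (A : 'I_n -> set (measurableTypeR R)) :
  (forall i, measurable (A i)) ->
  measurable [set x : 'rV[R]_n | forall i, A i (x ord0 i)].
Proof.
move=> mA.
have -> : [set x : 'rV[R]_n | forall i, A i (x ord0 i)] =
    \bigcap_(i in [set: 'I_n]) [set x | A i (x ord0 i)].
  by apply/seteqP; split => x /= Ax i; [move=> _|]; exact: Ax.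
apply: fin_bigcap_measurable => // i _.
by have := measurable_rV_coord i measurableT (mA i); rewrite setTI.
Qed.

(* This determines lebesgue_rV: boxes generate the Borel sigma-algebra. *)
Lemma lebesgue_rV_box (R : realType) n (A : 'I_n -> set (measurableTypeR R)) :
  (forall i, measurable (A i)) ->
  lebesgue_rV R n [set x | forall i, A i (x ord0 i)] =
  (\prod_(i < n) lebesgue_measure (A i))%E.
Proof.
elim: n A => [|n IHn] A mA.
  rewrite big_ord0 /= diracE mem_set//= => i; by case: i.
rewrite big_ord_recl /= /lebesgue_step /pushforward.
rewrite (_ : _ @^-1` _ = A ord0 `*`
  [set v : 'rV[R]_n | forall i : 'I_n, A (lift ord0 i) (v ord0 i)]).
  have mA' (i : 'I_n) : measurable (A (lift ord0 i)) by exact: mA.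
  rewrite product_measure1E//; last exact: (measurable_rV_box mA').
  by congr (_ * _)%E; exact: (IHn _ mA').
apply/seteqP; split => -[a v] /=.
- move=> Aav; split => [|i]; first by have := Aav ord0; rewrite mxE unlift_none.
  by have := Aav (lift ord0 i); rewrite mxE liftK.
- move=> [Aa Av] i; rewrite mxE.
  by case: (unliftP ord0 i) => [k ->|->] /=; first exact: Av.
Qed.

Section complex_integral.
Variables (R : realType) (n : nat).
Implicit Types (U : set 'rV[R]_n) (f : 'rV[R]_n -> R[i]).

Definition dotr (x y : 'rV[R]_n) : R := \sum_(i < n) x ord0 i * y ord0 i.

Definition expi (s : R) : R[i] := (cos s +i* sin s)%C.

Definition cmodulus (z : R[i]) : R := ComplexField.Normc.normc z.

Definition cmeasurable_fun U f :=
  measurable_fun U (fun t => complex.Re (f t) : measurableTypeR R) /\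
  measurable_fun U (fun t => complex.Im (f t) : measurableTypeR R).

Definition cintegral U f : R[i] :=
  (Rintegral (lebesgue_rV R n) U (fun t => complex.Re (f t)) +i*
   Rintegral (lebesgue_rV R n) U (fun t => complex.Im (f t)))%C.

Definition L2norm U f : \bar R :=
  Lnorm (lebesgue_rV R n) 2%:E (EFin \o ((cmodulus \o f) \_ U)).

Definition L2 U f := cmeasurable_fun U f /\ (L2norm U f < +oo)%E.

End complex_integral.

Section hypersurface.
Variables (R : realType) (m n : nat).
Implicit Types (U W : set 'rV[R]_m) (Gamma : 'rV[R]_m -> 'rV[R]_n).

Fixpoint Ck (k : nat) W Gamma : Prop :=
  if k is k'.+1 then
    (forall t, W t -> differentiable Gamma t) /\
    (forall v, Ck k' W (fun t => 'D_v Gamma t))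
  else forall t, W t -> {for t, continuous Gamma}.

(* U need not be open, so smoothness on U is smoothness near U. *)
Definition smooth U Gamma :=
  exists W, [/\ open W, U `<=` W & forall k, Ck k W Gamma].

Definition smooth_parametrisation U Gamma (S : set 'rV[R]_n) :=
  [/\ smooth U Gamma, set_inj U Gamma,
      forall t, U t -> row_free ('J Gamma t) & S = Gamma @` U].

(* The i-th row of 'J Gamma t is the i-th partial derivative of Gamma at t. *)
Definition unit_normal Gamma (t : 'rV[R]_m) (w : 'rV[R]_n) :=
  dotr w w = 1 /\ (forall i, dotr (row i ('J Gamma t)) w = 0).

Definition unit_normal_at U Gamma (x w : 'rV[R]_n) :=
  exists t, [/\ U t, Gamma t = x & unit_normal Gamma t w].

Definition first_fundamental Gamma (t : 'rV[R]_m) : 'M[R]_m :=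
  \matrix_(i, k) dotr (row i ('J Gamma t)) (row k ('J Gamma t)).

Definition second_fundamental Gamma (t : 'rV[R]_m) (w : 'rV[R]_n) : 'M[R]_m :=
  \matrix_(i, k)
    dotr ('D_(delta_mx ord0 i) (fun s => 'D_(delta_mx ord0 k) Gamma s) t) w.

(* The determinant of the shape operator for the choice w of unit normal. *)
Definition gaussian_curvature Gamma (t : 'rV[R]_m) (w : 'rV[R]_n) : R :=
  \det (second_fundamental Gamma t w) / \det (first_fundamental Gamma t).

Definition nonvanishing_curvature U Gamma :=
  forall t w, U t -> unit_normal Gamma t w -> gaussian_curvature Gamma t w != 0.

Definition extension_op U Gamma (f : 'rV[R]_m -> R[i]) (x : 'rV[R]_n) : R[i] :=
  cintegral U (fun t => expi (2 * pi * dotr x (Gamma t)) * f t).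

End hypersurface.

(* The modulus of a wedge product of n vectors of R^n, of top degree, is that of
   their determinant. *)
Definition wedge_abs (R : realType) n (w : 'I_n -> 'rV[R]_n) : R :=
  `|\det (\matrix_(j < n) w j)|.

Definition transverse (R : realType) m n (U : 'I_n -> set 'rV[R]_m)
    (Gamma : 'I_n -> 'rV[R]_m -> 'rV[R]_n) :=
  exists2 c : R, 0 < c & forall x w : 'I_n -> 'rV[R]_n,
    (forall j, unit_normal_at (U j) (Gamma j) (x j) (w j)) ->
    c <= wedge_abs w.

(* Main.v *)
Require Import Defs.
From mathcomp Require Import all_boot all_order all_algebra.
From mathcomp Require Import all_classical all_reals all_analysis.
From mathcomp Require Import measurable_realfun complex.
From mathcomp Require Import ring lra.

(** Write W for the product of the |E_j f_j|^(2/n), so that the multilinear bound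
    is an estimate for W in L^(n/(n-1)), the dual of L^n.

    Weights give the bound by testing against the extremal G = W^(1/(n-1)),
    cut off to a set of finite measure so that I = int G W = int G^n is finite.
    Hoelder's inequality with n factors applied to the products of g_j and
    |E_j f_j|^2 yields I <= C^2 I^(1/n) prod |f_j|^(2/n); one divides by I^(1/n)
    and exhausts the space ([gmean_norm_le_of_weights]).

    Conversely, duality turns the bound into int G W <= C^2 |G|_n prod |f_j|^(2/n),
    and the weights come from a Maurey-type factorisation argument, which needs
    convex families of functions in place of the squares |E_j f_j|^2.  Khintchine's
    inequality provides them: inserting independent random signs and using that
    the L^2 norm obeys the parallelogram law, the estimate extends to
    F_j = sum_i |E_j f_(j,i)|^2 with sum_i |f_(j,i)|^2 <= 1, and these F_j form a
    convex set K_j ([khintchine_root], [energies]).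

    On the product of the K_j one maximises the concave functional

      J(F) = int G prod_j (F_j + h)^(1/n) - |G|_n int v sum_j F_j^2,

    where v > 0 has integral at most 1 and h > 0 is a power of v, small enough for
    J to stay bounded by a multiple of |G|_n.  At a maximiser F* the first
    variation in the direction of F_j says that

      g_j = G prod_k (F*_k + h)^(1/n) / (F*_j + h)

    satisfies int g_j F_j <= D |G|_n on K_j, while the geometric mean of the g_j
    is exactly G.  The term h keeps the denominators positive.  The quadratic
    penalty changes the first variation only by a multiple of |G|_n, but it makes
    J uniformly concave, so that maximising sequences are Cauchy in L^2(v) and
    converge almost everywhere along a fast choice; Fatou's lemma then carries the
    variational inequality to the limit, which may lie outside of the K_j
    ([factorisation_weighted], [quadratic_factorisation]). *)

Set Implicit Arguments.
Unset Strict Implicit.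
Unset Printing Implicit Defensive.

Import Order.TTheory GRing.Theory Num.Theory.
Import numFieldNormedType.Exports.

Local Open Scope classical_set_scope.
Local Open Scope ring_scope.

(** * Elementary inequalities for the geometric mean *)

Section pointwise.
Variable R : realType.
Implicit Types (t u x y q : R) (n : nat).

Lemma powR_rootK n x : (0 < n)%N -> 0 <= x -> (x `^ n%:R^-1) ^+ n = x.
Proof.
move=> n0 x0; rewrite -powR_mulrn ?powR_ge0// -powRrM mulVf ?powRr1//.
by rewrite pnatr_eq0 -lt0n.
Qed.

Lemma ler_powR_root n x y : 0 <= x -> x <= y -> x `^ n%:R^-1 <= y `^ n%:R^-1.
Proof.
move=> x0 xy; apply: ge0_ler_powR => //.
  by rewrite nnegrE (le_trans x0).
Qed.

Definition gmean n (y : 'I_n -> R) : R := \prod_(j < n) y j `^ n%:R^-1.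

Lemma gmean_ge0 n (y : 'I_n -> R) : 0 <= gmean y.
Proof. by apply: prodr_ge0 => j _; exact: powR_ge0. Qed.

Lemma gmean_gt0 n (y : 'I_n -> R) : (forall j, 0 < y j) -> 0 < gmean y.
Proof. by move=> y0; apply: prodr_gt0 => j _; exact: powR_gt0. Qed.

Lemma le_gmean n (y z : 'I_n -> R) :
  (forall j, 0 <= y j <= z j) -> gmean y <= gmean z.
Proof.
move=> yz; apply: ler_prod => j _; rewrite powR_ge0/=.
by have /andP[y0 ?] := yz j; exact: ler_powR_root.
Qed.

Lemma gmeanX n (y : 'I_n -> R) : (0 < n)%N -> (forall j, 0 <= y j) ->
  gmean y ^+ n = \prod_(j < n) y j.
Proof.
by move=> n0 y0; rewrite -prodrXl; apply: eq_bigr => j _; rewrite powR_rootK.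
Qed.

Lemma gmeanM n (y z : 'I_n -> R) :
  (forall j, 0 <= y j) -> (forall j, 0 <= z j) ->
  gmean (fun j => y j * z j) = gmean y * gmean z.
Proof.
by move=> y0 z0; rewrite -big_split; apply: eq_bigr => j _; rewrite powRM.
Qed.

Lemma gmean_cst n (c : R) : (0 < n)%N -> 0 <= c -> gmean (fun _ : 'I_n => c) = c.
Proof.
move=> n0 c0; rewrite -[RHS](powR_rootK n0 c0) -[X in _ ^+ X](card_ord n).
by rewrite -prodr_const.
Qed.

Lemma gmean_le_mean n (y : 'I_n -> R) : (0 < n)%N -> (forall j, 0 <= y j) ->
  gmean y <= n%:R^-1 * \sum_(j < n) y j.
Proof.
move=> n0 y0; rewrite -(ler_pXn2r n0) ?nnegrE ?gmean_ge0//; last first.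
  by rewrite mulr_ge0 ?invr_ge0// sumr_ge0.
rewrite gmeanX// [_^-1 * _]mulrC.
have := (leif_AGM (A := 'I_n) (E := y) (fun j _ => y0 j)).1.
by rewrite card_ord.
Qed.

(** Weighted form of the inequality of means: apply it to the quotients y_j / z_j.
    With equality at y = z, it says that the geometric mean lies below its tangent
    hyperplanes, which is how concavity and Hoelder's inequality are derived. *)
Lemma gmean_le_scaled n (y z : 'I_n -> R) : (0 < n)%N ->
  (forall j, 0 <= y j) -> (forall j, 0 < z j) ->
  gmean y <= gmean z * (n%:R^-1 * \sum_(j < n) y j / z j).
Proof.
move=> n0 y0 z0.
have yz0 j : 0 <= y j / z j by rewrite divr_ge0// ltW.
rewrite (_ : y = fun j => z j * (y j / z j)); last first.
  by apply/funext => j; rewrite mulrC divfK// gt_eqF.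
rewrite gmeanM//; last by move=> j; exact: ltW.
rewrite ler_wpM2l ?gmean_ge0//.
apply: le_trans (gmean_le_mean n0 yz0) _.
rewrite ler_wpM2l ?invr_ge0//; apply: ler_sum => j _.
by rewrite [z j * _]mulrC divfK// gt_eqF.
Qed.

(** Concavity: average the tangent bounds of [gmean_le_scaled] taken at the
    midpoint. *)
Lemma gmean_midpoint n (y z : 'I_n -> R) : (0 < n)%N ->
  (forall j, 0 < y j) -> (forall j, 0 < z j) ->
  2^-1 * gmean y + 2^-1 * gmean z <= gmean (fun j => 2^-1 * y j + 2^-1 * z j).
Proof.
move=> n0 y0 z0; set w := fun j => _.
have w0 j : 0 < w j by rewrite addr_gt0// mulr_gt0.
have gy := gmean_le_scaled n0 (fun j => ltW (y0 j)) w0.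
have gz := gmean_le_scaled n0 (fun j => ltW (z0 j)) w0.
have : 2^-1 * (gmean w * (n%:R^-1 * \sum_(j < n) y j / w j)) +
    2^-1 * (gmean w * (n%:R^-1 * \sum_(j < n) z j / w j)) = gmean w.
  transitivity (gmean w * (n%:R^-1 *
      \sum_(j < n) (2^-1 * y j + 2^-1 * z j) / w j)).
    under [in RHS]eq_bigr do rewrite mulrDl -!mulrA.
    by rewrite big_split/= -!mulr_sumr; ring.
  rewrite (eq_bigr (fun _ => 1)); last first.
    by move=> j _; rewrite [X in X / _](_ : _ = w j)// divff// gt_eqF//; exact: w0.
  by rewrite sumr_const card_ord mulVf ?mulr1// pnatr_eq0 -lt0n.
lra.
Qed.

(** A lower bound for the increment of the n-th root which is linear near u = 0
    with the right slope 1/n and holds for all u >= 0, so that it can be used under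
    an integral before letting a parameter tend to 0. *)
Lemma powR_rootD1_ge n u : (0 < n)%N -> 0 <= u ->
  1 + u / (n%:R * (1 + u)) <= (1 + u) `^ n%:R^-1.
Proof.
move=> n0 u0; set a := _ `^ _.
have u1 : 0 < 1 + u by lra.
have a1 : 1 <= a.
  have : 1 `^ n%:R^-1 <= a by rewrite ler_powR_root//; lra.
  by rewrite powR1.
have an : a ^+ n = 1 + u by rewrite powR_rootK// ltW.
have n0' : 0 < n%:R :> R by rewrite ltr0n.
rewrite -lerBrDl ler_pdivrMr ?mulr_gt0// -an.
have -> : u = a ^+ n - 1 by rewrite an; ring.
rewrite subrX1 ler_wpM2l ?subr_ge0// -[n in n%:R](card_ord n) -sumr_const.
rewrite mulr_suml; apply: ler_sum => i _; rewrite mul1r.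
by rewrite ler_weXn2l// ltnW.
Qed.

Lemma powR_rootD n x y : (0 < n)%N -> 0 <= x -> 0 <= y ->
  (x + y) `^ n%:R^-1 <= x `^ n%:R^-1 + y `^ n%:R^-1.
Proof.
move=> n0 x0 y0; rewrite -(ler_pXn2r n0) ?nnegrE ?addr_ge0 ?powR_ge0//.
rewrite powR_rootK ?addr_ge0//.
rewrite -{1}(powR_rootK n0 x0) -{1}(powR_rootK n0 y0).
set a := x `^ _; set b := y `^ _.
have a0 : 0 <= a by exact: powR_ge0.
have b0 : 0 <= b by exact: powR_ge0.
clearbody a b; clear x y x0 y0; case: n n0 => // n _.
elim: n => [|n IH]; first by rewrite !expr1.
rewrite [leRHS]exprS; apply: le_trans (ler_wpM2l (addr_ge0 a0 b0) IH).
rewrite [a ^+ n.+2]exprS [b ^+ n.+2]exprS mulrDl !mulrDr.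
have := mulr_ge0 a0 (exprn_ge0 n.+1 b0).
have := mulr_ge0 b0 (exprn_ge0 n.+1 a0).
lra.
Qed.

(** Adding a small constant to bounded factors costs a multiple of its n-th root:
    every term of the expanded product but the first contains that root. *)
Lemma gmeanD_le n (y : 'I_n -> R) (h b : R) : (0 < n)%N -> 0 <= h <= 1 -> 1 <= b ->
  (forall j, 0 <= y j <= b) ->
  gmean (fun j => y j + h) <= gmean y + (b + 2) ^+ n * h `^ n%:R^-1.
Proof.
move=> n0 /andP[h0 h1] b1 yb; set e := h `^ _.
have e0 : 0 <= e by exact: powR_ge0.
have e1 : e <= 1 by have := ler_powR_root n h0 h1; rewrite powR1.
set c := fun j => y j `^ (n%:R^-1 : R).
have c0 j : 0 <= c j by exact: powR_ge0.
have cb j : c j <= b.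
  have /andP[y0 yb'] := yb j.
  apply: (@le_trans _ _ (b `^ n%:R^-1)); first exact: ler_powR_root.
  by rewrite ler1_powR// invf_le1 ?ltr0n// ler1n.
apply: (@le_trans _ _ (\prod_(j < n) (c j + e))).
  apply: ler_prod => j _; rewrite powR_ge0/=.
  by have /andP[y0 _] := yb j; exact: powR_rootD.
rewrite /gmean -/c.
have H (s : seq 'I_n) : \prod_(j <- s) (c j + e) <=
    \prod_(j <- s) c j + (b + 2) ^+ size s * e /\
    \prod_(j <- s) c j <= (b + 2) ^+ size s.
  elim: s => [|j s [IH1 IH2]].
    by rewrite !big_nil expr0 mul1r; split => //; lra.
  rewrite !big_cons /= exprS.
  have P0 : 0 <= \prod_(j <- s) c j by apply: prodr_ge0.
  have b2 : 0 <= (b + 2) ^+ size s by apply: exprn_ge0; lra.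
  split; last by apply: ler_pM => //; have := cb j; lra.
  have : (c j + e) * \prod_(j <- s) (c j + e) <=
         (c j + e) * (\prod_(j <- s) c j + (b + 2) ^+ size s * e).
    by rewrite ler_wpM2l ?addr_ge0.
  move/le_trans; apply; rewrite mulrDl mulrDr.
  have : e * (\prod_(j0 <- s) c j0 + (b + 2) ^+ size s * e) <=
     e * (2 * (b + 2) ^+ size s).
    rewrite ler_wpM2l//.
    have : (b + 2) ^+ size s * e <= (b + 2) ^+ size s * 1 by rewrite ler_wpM2l.
    lra.
  have : c j * ((b + 2) ^+ size s * e) <= b * ((b + 2) ^+ size s * e).
    by rewrite ler_wpM2r ?mulr_ge0.
  set B := _ ^+ size s; set P := \prod_(_ <- _) _ => ? ?.
  rewrite (_ : (b + 2) * B * e = b * (B * e) + e * (2 * B)); last by ring.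
  lra.
by have := (H (index_enum 'I_n)).1; rewrite -[index_enum _]enumT size_enum_ord.
Qed.

(** Comparison of a concave power with a quadratic polynomial; integrated, it
    bounds the q-th moment of a nonnegative variable of mean 1 from below by means
    of its second moment alone. *)
Lemma parabola_le_powR t q : 0 <= t -> 0 <= q <= 1 -> t - t ^+ 2 / 4 <= t `^ q.
Proof.
move=> t0 /andP[q0 q1].
have [t1|t1] := leP 1 t.
  apply: (@le_trans _ _ 1).
    have : 0 <= (1 - t / 2) ^+ 2 by exact: sqr_ge0.
    by rewrite (_ : _ ^+ 2 = 1 - (t - t ^+ 2 / 4)); [lra|field].
  by rewrite -(powRr0 t) ler_powR.
have [->|tn0] := eqVneq t 0; first by rewrite expr0n/= mul0r subr0 powR_ge0.
apply: (@le_trans _ _ t); last by rewrite ger1_powR// lt_neqAle eq_sym tn0 t0 ltW.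
by have := sqr_ge0 t; lra.
Qed.

Lemma powR_le_D1 t q : 0 <= t -> 0 <= q <= 1 -> t `^ q <= 1 + t.
Proof.
move=> t0 /andP[q0 q1]; have [t1|t1] := leP 1 t.
  by apply: le_trans (ler1_powR t1 q1) _; lra.
have: t `^ q <= 1 `^ q by rewrite ge0_ler_powR// ?nnegrE// ltW.
by rewrite powR1; lra.
Qed.

Lemma mulrX_le n x y : 0 <= x -> 0 <= y -> x * y ^+ n <= x ^+ n.+1 + y ^+ n.+1.
Proof.
move=> x0 y0; have [xy|yx] := leP x y.
  rewrite [y ^+ n.+1]exprS; have : x * y ^+ n <= y * y ^+ n by rewrite ler_wpM2r ?exprn_ge0.
  by have := exprn_ge0 n.+1 x0; lra.
rewrite [x ^+ n.+1]exprS; have : x * y ^+ n <= x * x ^+ n.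
  by rewrite ler_wpM2l// lerXn2r ?nnegrE// ltW.
by have := exprn_ge0 n.+1 y0; lra.
Qed.

Lemma powR_prod (I : Type) (r : seq I) (x : I -> R) (s : R) :
  (forall i, 0 <= x i) -> (\prod_(i <- r) x i) `^ s = \prod_(i <- r) x i `^ s.
Proof.
move=> x0; elim: r => [|i r IH]; first by rewrite !big_nil powR1.
by rewrite !big_cons powRM ?IH// prodr_ge0.
Qed.

Lemma ler_root2 (x c y : R) : 0 <= x -> 0 <= c -> 0 <= y ->
  (x `^ 2^-1 <= c * y `^ 2^-1) = (x <= c ^+ 2 * y).
Proof.
move=> x0 c0 y0; rewrite -(@ler_pXn2r _ 2)// ?nnegrE ?mulr_ge0 ?powR_ge0//.
by rewrite exprMn !powR_rootK.
Qed.

End pointwise.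

(** * An integrable positive weight *)

Section weight.
Context d (T : measurableType d) (R : realType).
Variable mu : {sigma_finite_measure set T -> \bar R}.
Local Open Scope ereal_scope.

Lemma sigma_finite_weight : exists v : T -> R,
  [/\ measurable_fun setT v, forall x, (0 < v x <= 1)%R &
      \int[mu]_x (v x)%:E <= 1].
Proof.
(* The weight is a series of indicators of sets of finite measure, each divided
   by its measure and by a power of 2. *)
have [A UA Afin] := sigma_finiteT mu.
have mA k : measurable (A k) by exact: (Afin k).1.
have muA k : mu (A k) \is a fin_num.
  by rewrite ge0_fin_numE//; exact: (Afin k).2.
pose m k := fine (mu (A k)).
have m0 k : (0 <= m k)%R by rewrite fine_ge0.
pose c k : R := (1 / (2 ^ k.+1)%:R / (1 + m k))%R.
have p2 k : (0 < (2 ^ k.+1)%:R :> R)%R by rewrite ltr0n expn_gt0.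
have c0 k : (0 < c k)%R by rewrite !divr_gt0//; have := m0 k; lra.
have c1 k : (c k * (1 + m k) = 1 / (2 ^ k.+1)%:R)%R.
  by rewrite divfK// gt_eqF//; have := m0 k; lra.
pose f k x : \bar R := (c k * \1_(A k) x)%:E.
have f0 k x : 0 <= f k x by rewrite lee_fin mulr_ge0// ltW.
have mf k : measurable_fun setT (f k).
  by apply/measurable_EFinP; apply: measurable_funM => //; exact/measurable_indicP.
have W1 x : \sum_(k <oo) f k x <= 1.
  apply: le_trans (epsilon_trick0 xpredT (@ler01 R)).
  apply: lee_nneseries => // k _; rewrite lee_fin.
  rewrite -c1 ler_wpM2l ?(ltW (c0 k))//.
  by rewrite indicE; case: (_ \in _) => /=; have := m0 k; lra.
have W0 x : 0 < \sum_(k <oo) f k x.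
  have [k _ Ak] : (\bigcup_k A k) x by rewrite -UA.
  rewrite (@lt_le_trans _ _ (f k x))//.
    by rewrite lte_fin indicE mem_set// mulr1.
  by rewrite (@nneseriesD1 _ _ k)// leeDl// nneseries_ge0.
have Wfin x : \sum_(k <oo) f k x \is a fin_num.
  by rewrite ge0_fin_numE ?(ltW (W0 x))//; apply: le_lt_trans (W1 x) _; rewrite ltry.
exists (fun x => fine (\sum_(k <oo) f k x)); split.
- apply: (measurableT_comp (fine_measurable measurableT)) => //.
  exact: ge0_emeasurable_sum.
- by move=> x; rewrite -!lte_fin -!lee_fin fineK ?W0 ?W1.
- under eq_integral do rewrite fineK//.
  rewrite integral_nneseries//.
  apply: le_trans (epsilon_trick0 xpredT (@ler01 R)).
  apply: lee_nneseries => // k _; first by move=> _; exact: integral_ge0.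
  under eq_integral do rewrite /f EFinM.
  rewrite ge0_integralZl_EFin//; last by exact: ltW.
    rewrite integral_indic// setIT -[X in _ * X](@fineK _ (mu (A k)))//.
    rewrite -EFinM lee_fin -c1.
    by rewrite ler_wpM2l ?(ltW (c0 k))//; apply: ler_wpDl.
  by apply/measurable_EFinP/measurable_indicP.
Qed.

End weight.

(** * Convergence and integration tools *)

Section tools.
Context d (T : measurableType d) (R : realType).
Variable mu : {measure set T -> \bar R}.

(** By monotone convergence the weighted sum of the increments has a finite
    integral, hence is finite almost everywhere, and there the telescoping series
    converges absolutely. *)
Lemma ae_cvg_summable_increments (v : T -> R) (u : nat -> T -> R) :
  measurable_fun setT v -> (forall x, 0 < v x) ->
  (forall k, measurable_fun setT (u k)) ->
  (\sum_(k <oo) \int[mu]_x (v x * `|u k.+1 x - u k x|)%:E < +oo)%E ->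
  {ae mu, forall x, cvgn (fun k => u k x)}.
Proof.
move=> mv v0 mu_ ufin.
pose f k x : \bar R := (v x * `|u k.+1 x - u k x|)%:E.
have f0 k x : (0 <= f k x)%E by rewrite lee_fin mulr_ge0// ltW.
have mf k : measurable_fun setT (f k).
  apply/measurable_EFinP; apply: measurable_funM => //.
  by apply: measurableT_comp => //; exact: measurable_funB.
have intf : mu.-integrable setT (fun x => \sum_(k <oo) f k x)%E.
  apply/integrableP; split; first exact: ge0_emeasurable_sum.
  under eq_integral do rewrite gee0_abs ?nneseries_ge0//.
  by rewrite integral_nneseries.
apply: filterS (integrable_ae measurableT intf) => x /(_ I) xfin.
set w := fun k => u k x.
suff : cvgn (series (telescope w)).
  move=> wcvg; rewrite (_ : w = cst (w 0%N) \+ series (telescope w)).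
    by apply: is_cvgD => //; exact: is_cvg_cst.
  by apply/funext => k; exact: eq_sum_telescope.
apply: normed_cvg.
rewrite (_ : [normed series _] = fun k => \sum_(0 <= i < k) `|telescope w i|)//.
apply: nondecreasing_is_cvgn.
  by apply/nondecreasing_seqP => k; rewrite big_nat_recr//= lerDl.
exists (fine (\sum_(k <oo) f k x) / v x) => _ [k _ <-].
rewrite ler_pdivlMr// -lee_fin fineK//.
apply: le_trans (nneseries_lim_ge k _) => //.
by rewrite sumEFin lee_fin mulrC mulr_sumr.
Qed.

Lemma measurable_gmean n (f : 'I_n -> T -> R) :
  (forall j, measurable_fun setT (f j)) ->
  measurable_fun setT (fun x => gmean (f^~ x)).
Proof.
move=> mf; apply: measurable_prod => j _.
by apply: (measurableT_comp (measurable_powR _ )).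
Qed.

(** Hoelder's inequality with n equal exponents. If all the bounds c_j are
    positive it is the integral of [gmean_le_scaled]; if some c_j vanishes, the
    corresponding factor is zero almost everywhere. *)
Lemma gmean_hoelder n (u : 'I_n -> T -> R) (c : 'I_n -> R) : (0 < n)%N ->
  (forall j, measurable_fun setT (u j)) -> (forall j x, 0 <= u j x) ->
  (forall j, 0 <= c j) -> (forall j, \int[mu]_x (u j x)%:E <= (c j)%:E)%E ->
  (\int[mu]_x (gmean (u^~ x))%:E <= (gmean c)%:E)%E.
Proof.
move=> n0 mu_ u0 c0 uc; have nn0 : n%:R != 0 :> R by rewrite pnatr_eq0 -lt0n.
have mgu : measurable_fun setT (fun x => (gmean (u^~ x))%:E).
  by apply/measurable_EFinP; exact: measurable_gmean.
have [cpos|[j cj]] : (forall j, 0 < c j) \/ exists j, c j = 0.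
- have [cpos|/existsNP[j cj]] := pselect (forall j, 0 < c j); first by left.
  by right; exists j; apply/eqP; move/negP: cj; rewrite lt_neqAle c0 andbT negbK eq_sym.
- apply: (@le_trans _ _ (\int[mu]_x ((gmean c)%:E *
      \sum_(j < n) (n%:R^-1 / c j)%:E * (u j x)%:E))%E).
    apply: ge0_le_integral => //.
    + by move=> x _; rewrite lee_fin gmean_ge0.
    + apply: measurable_funeM; apply: emeasurable_sum => j.
      by apply: measurable_funeM; exact/measurable_EFinP.
    + move=> x _; under eq_bigr do rewrite -EFinM.
      rewrite sumEFin -EFinM lee_fin.
      apply: le_trans (gmean_le_scaled n0 (fun j => u0 j x) cpos) _.
      rewrite mulr_sumr ler_wpM2l ?gmean_ge0//.
      by apply: ler_sum => j _; rewrite mulrA mulrAC.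
  have k0 j : 0 <= n%:R^-1 / c j by rewrite divr_ge0// invr_ge0.
  rewrite ge0_integralZl//; last 3 first.
  + apply: emeasurable_sum => j.
    by apply: measurable_funeM; exact/measurable_EFinP.
  + by move=> x _; apply: sume_ge0 => j _; rewrite -EFinM lee_fin mulr_ge0.
  + by rewrite lee_fin gmean_ge0.
  rewrite ge0_integral_sum//; last 2 first.
  + by move=> j; apply: measurable_funeM; exact/measurable_EFinP.
  + by move=> j x _; rewrite -EFinM lee_fin mulr_ge0.
  rewrite -[leRHS]mule1; apply: lee_wpmul2l; first by rewrite lee_fin gmean_ge0.
  apply: (@le_trans _ _ (\sum_(j < n) (n%:R^-1)%:E)%E).
    apply: lee_sum => j _; rewrite ge0_integralZl_EFin//; last 2 first.
    + by move=> x _; rewrite lee_fin.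
    + exact/measurable_EFinP.
    apply: (@le_trans _ _ ((n%:R^-1 / c j)%:E * (c j)%:E)%E).
      by apply: lee_wpmul2l; rewrite ?lee_fin.
    by rewrite -EFinM lee_fin divfK// gt_eqF.
  by rewrite sumEFin lee_fin sumr_const card_ord -[_ *+ n]mulr_natr mulVf.
- have uj0 : {ae mu, forall x, setT x -> (u j x)%:E = 0%E}.
    apply/(ae_eq_integral_abs mu measurableT); first exact/measurable_EFinP.
    apply/eqP; rewrite eq_le; apply/andP; split; last exact: integral_ge0.
    by under eq_integral do rewrite gee0_abs ?lee_fin//; rewrite -[0]/(0%:E) -cj.
  rewrite (ae_eq_integral (cst 0%E))//; last first.
    apply: filterS uj0 => x /(_ I) [ujx] _; congr EFin.
    by rewrite /gmean (bigD1 j)//= ujx powR0 ?mul0r// invr_eq0.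
  by rewrite integral0 lee_fin gmean_ge0.
Qed.

Lemma measurable_funV (f : T -> R) : measurable_fun setT f ->
  (forall x, 0 < f x) -> measurable_fun setT (fun x => (f x)^-1).
Proof.
move=> mf f0; rewrite (_ : (fun _ => _) = (fun x => f x `^ (-1))).
  exact: (measurableT_comp (measurable_powR _)).
by apply/funext => x; rewrite powR_inv1// ltW.
Qed.

End tools.

Section limits.
Variable R : realType.

Lemma cvg_powR (u : nat -> R) (l q : R) : 0 < l ->
  u k @[k --> \oo] --> l -> (fun k => u k `^ q : R^o) @ \oo --> (l `^ q : R^o).
Proof.
move=> l0 ul; have powc : {for l, continuous (fun x : R => x `^ q)}.
  apply: differentiable_continuous; apply/derivable1_diffP.
  by apply: derivable_powR; rewrite in_itv/= l0.
exact: (cvg_comp _ _ ul powc).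
Qed.

Lemma cvg_gmean n (u : nat -> 'I_n -> R) (l : 'I_n -> R) :
  (forall j, 0 < l j) -> (forall j, u k j @[k --> \oo] --> l j) ->
  gmean (u k) @[k --> \oo] --> gmean l.
Proof.
move=> l0 ul; apply: cvg_big => [|j _]; last exact: cvg_powR.
exact: mul_continuous.
Qed.

End limits.

(** * Factorisation through a convex family *)

(** The sets K j play the part of the convexified squares |E_j f|^2 of unit vectors
    f, and a that of the norm of G in L^n; the weight v will define both the
    perturbation h and the quadratic penalty. *)
Section factorisation.
Context d (T : measurableType d) (R : realType).
Variable mu : {measure set T -> \bar R}.
Variables (m : nat).
Local Notation n := m.+1.
Variables (K : 'I_n -> set (T -> R)) (G v : T -> R) (a A b : R).
Hypotheses (a0 : 0 < a) (b1 : 1 <= b).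
Hypotheses (mG : measurable_fun setT G) (G0 : forall x, 0 <= G x).
Hypothesis normG : (\int[mu]_x (G x ^+ n)%:E <= (a ^+ n)%:E)%E.
Hypotheses (mv : measurable_fun setT v) (v01 : forall x, 0 < v x <= 1).
Hypothesis intv : (\int[mu]_x (v x)%:E <= 1)%E.
Hypothesis K0 : forall j, K j (fun=> 0).
Hypothesis mK : forall j F, K j F -> measurable_fun setT F.
Hypothesis Kb : forall j F, K j F -> forall x, 0 <= F x <= b.
Hypothesis Kconv : forall j F F' (s : R), K j F -> K j F' -> 0 <= s <= 1 ->
  K j (fun x => (1 - s) * F x + s * F' x).
Hypothesis Kint : forall F : 'I_n -> T -> R, (forall j, K j (F j)) ->
  (\int[mu]_x (G x * gmean (F^~ x))%:E <= (A * a)%:E)%E.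

Let n0 : (0 < n)%N. Proof. by []. Qed.
Let v0 x : 0 < v x. Proof. by have /andP[] := v01 x. Qed.
Let v1 x : v x <= 1. Proof. by have /andP[] := v01 x. Qed.

(** The exponent makes the n-th root of h equal to v^(n-1), which Young's
    inequality pairs with G in L^n against the integrable function v >= v^n. *)
Let h x := v x ^+ (m * n).
Let h0 x : 0 < h x. Proof. exact: exprn_gt0. Qed.
Let h1 x : h x <= 1. Proof. by rewrite exprn_ile1// ltW. Qed.
Let mh : measurable_fun setT h. Proof. exact: measurable_funX. Qed.
Let hroot x : h x `^ n%:R^-1 = v x ^+ m.
Proof.
rewrite /h exprM -powR_mulrn; last by rewrite exprn_ge0// ltW.
by rewrite -powRrM mulfV ?powRr1 ?pnatr_eq0// exprn_ge0// ltW.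
Qed.

Let A1 : R := A + 2 * (b + 2) ^+ n.
Let b2 : 0 <= (b + 2) ^+ n.
Proof. by apply: exprn_ge0; have := b1; lra. Qed.

Definition admissible (F : 'I_n -> T -> R) := forall j, K j (F j).

Let P (F : 'I_n -> T -> R) x := gmean (fun j => F j x + h x).

Let P0 F x : 0 <= P F x. Proof. exact: gmean_ge0. Qed.

Let Fh0 F (adF : admissible F) j x : 0 < F j x + h x.
Proof. by have /andP[F0 _] := Kb (adF j) x; rewrite ltr_wpDl. Qed.

Let mP F : (forall j, measurable_fun setT (F j)) -> measurable_fun setT (P F).
Proof. by move=> mF; apply: measurable_gmean => j; exact: measurable_funD. Qed.

Let mGP F : (forall j, measurable_fun setT (F j)) ->
  measurable_fun setT (fun x => G x * P F x).
Proof. by move=> mF; apply: measurable_funM => //; exact: mP. Qed.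

Let intGv : (\int[mu]_x (G x * v x ^+ m)%:E <= (2 * a)%:E)%E.
Proof.
pose k := a / a ^+ n.
have k0 : 0 <= k by rewrite divr_ge0// ?exprn_ge0// ltW.
have ka : k * a ^+ n = a by rewrite divfK// gt_eqF// exprn_gt0.
apply: (@le_trans _ _ (\int[mu]_x (k%:E * (G x ^+ n)%:E + a%:E * (v x)%:E))%E).
  apply: ge0_le_integral => //.
  - by move=> x _; rewrite lee_fin mulr_ge0// exprn_ge0// ltW.
  - apply/measurable_EFinP; apply: measurable_funM => //; exact: measurable_funX.
  - apply/measurable_EFinP; apply: measurable_funD; apply: measurable_funM => //.
    exact: measurable_funX.
  - move=> x _; rewrite -!EFinM -EFinD lee_fin.
    have -> : G x * v x ^+ m = a * (G x / a * v x ^+ m).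
      by rewrite mulrA mulrCA divff ?gt_eqF// mulr1.
    have -> : k * G x ^+ n = a * (G x / a) ^+ n.
      by rewrite expr_div_n /k; ring.
    rewrite -mulrDr ler_wpM2l ?(ltW a0)//.
    apply: le_trans (mulrX_le m _ (ltW (v0 x))) _.
      by rewrite divr_ge0// ltW.
    by rewrite lerD2l exprS ler_piMr ?(ltW (v0 x))// exprn_ile1// ltW.
rewrite ge0_integralD//; last 4 first.
- by move=> x _; rewrite -EFinM lee_fin mulr_ge0// exprn_ge0.
- apply/measurable_EFinP; apply: measurable_funM => //; exact: measurable_funX.
- by move=> x _; rewrite -EFinM lee_fin mulr_ge0// ltW.
- by apply/measurable_EFinP; apply: measurable_funM.
rewrite !ge0_integralZl_EFin//; last 5 first.
- by move=> x _; rewrite lee_fin ltW.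
- exact/measurable_EFinP.
- exact: ltW.
- by move=> x _; rewrite lee_fin exprn_ge0.
- by apply/measurable_EFinP; exact: measurable_funX.
rewrite (_ : 2 * a = k * a ^+ n + a * 1); last by rewrite ka; ring.
rewrite EFinD !EFinM; apply: leeD; apply: lee_wpmul2l => //; rewrite lee_fin//.
exact: ltW.
Qed.

(** Replacing F_j by F_j + h keeps the functional bounded by a multiple of a. *)
Let intGP F : admissible F -> (\int[mu]_x (G x * P F x)%:E <= (A1 * a)%:E)%E.
Proof.
move=> adF.
apply: (@le_trans _ _ (\int[mu]_x ((G x * gmean (F^~ x))%:E +
    ((b + 2) ^+ n)%:E * (G x * v x ^+ m)%:E))%E).
  apply: ge0_le_integral => //.
  - by move=> x _; rewrite lee_fin mulr_ge0.
  - apply/measurable_EFinP; apply: mGP => j; exact: mK (adF j).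
  - apply/measurable_EFinP; apply: measurable_funD; apply: measurable_funM => //.
      by apply: measurable_gmean => j; exact: mK (adF j).
    by apply: measurable_funM => //; exact: measurable_funX.
  - move=> x _; rewrite -!EFinM -EFinD lee_fin mulrCA -mulrDr ler_wpM2l//.
    by rewrite -hroot; apply: gmeanD_le => //;
      [rewrite h1 ltW|move=> j; exact: Kb (adF j) x].
rewrite ge0_integralD//; last 4 first.
- by move=> x _; rewrite lee_fin mulr_ge0// gmean_ge0.
- apply/measurable_EFinP; apply: measurable_funM => //.
  by apply: measurable_gmean => j; exact: mK (adF j).
- by move=> x _; rewrite -EFinM lee_fin !mulr_ge0// exprn_ge0// ltW.
- apply/measurable_EFinP; apply: measurable_funM => //.
  by apply: measurable_funM => //; exact: measurable_funX.
rewrite ge0_integralZl_EFin//; last 2 first.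
- by move=> x _; rewrite lee_fin mulr_ge0// exprn_ge0// ltW.
- apply/measurable_EFinP.
  by apply: measurable_funM => //; exact: measurable_funX.
rewrite (_ : A1 * a = A * a + (b + 2) ^+ n * (2 * a)); last by rewrite /A1; ring.
rewrite EFinD (EFinM _ (2 * a)); apply: leeD; first exact: Kint.
by apply: lee_wpmul2l; rewrite ?lee_fin.
Qed.

Let sq (F : 'I_n -> T -> R) x := \sum_(j < n) F j x ^+ 2.

Let sq0 F x : 0 <= sq F x.
Proof. by apply: sumr_ge0 => j _; exact: sqr_ge0. Qed.

Let msq F : (forall j, measurable_fun setT (F j)) -> measurable_fun setT (sq F).
Proof. by move=> mF; apply: measurable_sum => j; exact: measurable_funX. Qed.

Let iv : mu.-integrable setT (EFin \o v).
Proof.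
apply/integrableP; split; first exact/measurable_EFinP.
under eq_integral do rewrite gee0_abs ?lee_fin ?(ltW (v0 _))//.
exact: le_lt_trans intv (ltry _).
Qed.

Let iGP F : admissible F -> mu.-integrable setT (fun x => (G x * P F x)%:E).
Proof.
move=> adF; apply/integrableP; split.
  by apply/measurable_EFinP; apply: mGP => j; exact: mK (adF j).
under eq_integral do rewrite gee0_abs ?lee_fin ?mulr_ge0//.
exact: le_lt_trans (intGP adF) (ltry _).
Qed.


Let ivsq (F : 'I_n -> T -> R) (c : R) : (forall j, measurable_fun setT (F j)) ->
  (forall j x, `|F j x| <= c) ->
  mu.-integrable setT (fun x => (a * v x * sq F x)%:E).
Proof.
move=> mF Fc.
apply: (@le_integrable _ _ _ _ _ measurableT _
    (fun x => ((a * (n%:R * c ^+ 2))%:E * (v x)%:E)%E)).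
- apply/measurable_EFinP; apply: measurable_funM; first exact: measurable_funM.
  exact: msq.
- move=> x _; rewrite -EFinM !abse_EFin lee_fin.
  have av0 : 0 <= a * v x by rewrite mulr_ge0// ltW.
  have c20 : 0 <= a * (n%:R * c ^+ 2).
    by rewrite mulr_ge0 ?(ltW a0)// mulr_ge0// sqr_ge0.
  rewrite !ger0_norm ?(mulr_ge0 av0)// ?(mulr_ge0 c20) ?(ltW (v0 x))//.
  rewrite mulrAC ler_wpM2r ?(ltW (v0 x))// ler_wpM2l ?(ltW a0)//.
  rewrite mulr_natl -[X in _ *+ X](card_ord n) -sumr_const.
  apply: ler_sum => j _; rewrite -real_normK ?num_real//.
  by rewrite lerXn2r ?nnegrE// (le_trans _ (Fc j x)).
- exact: (integrableZl measurableT _ iv).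
Qed.

(** The integrand of the functional J to be maximised. The factor a makes the
    penalty comparable with the main term for every G. *)
Let psi F x := G x * P F x - a * v x * sq F x.

Let Kabs F j x : admissible F -> `|F j x| <= b.
Proof. by move=> adF; have /andP[? ?] := Kb (adF j) x; rewrite ger0_norm. Qed.

Let ipsi F : admissible F -> mu.-integrable setT (EFin \o psi F).
Proof.
move=> adF; rewrite (_ : _ \o _ = fun x => (G x * P F x)%:E - (a * v x * sq F x)%:E)%E//.
apply: integrableB => //; first exact: iGP.
by apply: (@ivsq _ b) => j *; [exact: mK (adF j)|exact: Kabs].
Qed.

Let J F := \int[mu]_x psi F x.

Let J_le F : admissible F -> J F <= A1 * a.
Proof.
move=> adF; rewrite /J /Rintegral -lee_fin fineK; last first.
  exact: (integrable_fin_num measurableT (ipsi adF)).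
apply: le_trans (intGP adF); apply: le_integral => //.
- exact: ipsi.
- exact: iGP.
- move=> x _; rewrite lee_fin /psi lerBlDr lerDl mulr_ge0//.
  by rewrite mulr_ge0 ?(ltW a0) ?(ltW (v0 x)).
Qed.

Let SJ := sup [set J F | F in admissible].

Let hsJ : has_sup [set J F | F in admissible].
Proof.
split; first by exists (J (fun _ _ => 0)), (fun _ _ => 0).
by exists (A1 * a) => _ [F adF <-]; exact: J_le.
Qed.

Let J_sup F : admissible F -> J F <= SJ.
Proof. by move=> adF; apply: ub_le_sup; [exact: hsJ.2|exists F]. Qed.

(** The k-th member of the maximising sequence misses the supremum by less than
    a 4^-k, which makes the distances to the next member summable. *)
Let eps k : R := a * (2^-1 ^+ k) ^+ 2.

Let maximising : exists F : nat -> 'I_n -> T -> R,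
  forall k, admissible (F k) /\ SJ - eps k < J (F k).
Proof.
have H k : exists F, admissible F /\ SJ - eps k < J F.
  have e0 : 0 < eps k by rewrite mulr_gt0// !exprn_gt0// invr_gt0.
  have [_ [F adF <-] ?] := sup_adherent e0 hsJ.
  by exists F.
by have [F HF] := choice H; exists F.
Qed.

Let mid (F F' : 'I_n -> T -> R) j x : R := (1 - 2^-1) * F j x + 2^-1 * F' j x.

Let ad_mid F F' : admissible F -> admissible F' -> admissible (mid F F').
Proof. by move=> adF adF' j; apply: Kconv => //; lra. Qed.

(** Uniform concavity: the geometric mean is concave, and the parallelogram law
    for the penalty gains the square of the distance. *)
Let psi_mid F F' x : admissible F -> admissible F' ->
  2^-1 * psi F x + 2^-1 * psi F' x +
    4^-1 * (a * v x * sq (fun j x => F' j x - F j x) x) <= psi (mid F F') x.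
Proof.
move=> adF adF'.
have sqE : sq (mid F F') x = 2^-1 * sq F x + 2^-1 * sq F' x -
    4^-1 * sq (fun j x => F' j x - F j x) x.
  rewrite /sq !mulr_sumr -big_split -sumrB; apply: eq_bigr => j _ /=.
  by rewrite /mid; field.
have := gmean_midpoint n0 (fun j => Fh0 adF j x) (fun j => Fh0 adF' j x).
rewrite (_ : gmean (fun j => 2^-1 * _ + _) = P (mid F F') x); last first.
  by congr gmean; apply/funext => j; rewrite /mid; field.
rewrite -/(P F x) -/(P F' x) => /(ler_wpM2l (G0 x)).
rewrite /psi sqE; lra.
Qed.

(** Two nearly maximising families are close in L^2(v), since their midpoint
    cannot beat the supremum. *)
Let J_mid F F' : admissible F -> admissible F' ->
  2^-1 * J F + 2^-1 * J F' +
  4^-1 * \int[mu]_x (a * v x * sq (fun j x => F' j x - F j x) x) <= SJ.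
Proof.
move=> adF adF'; apply: le_trans (J_sup (ad_mid adF adF')).
have iD : mu.-integrable setT
    (EFin \o (fun x => a * v x * sq (fun j x => F' j x - F j x) x)).
  apply: (@ivsq _ (b + b)) => [j|j x].
    by apply: measurable_funB; [exact: mK (adF' j)|exact: mK (adF j)].
  by apply: le_trans (ler_normB _ _) _; apply: lerD; exact: Kabs.
have iF := ipsi adF; have iF' := ipsi adF'.
have iZ (f : T -> R) (c : R) : mu.-integrable setT (EFin \o f) ->
    mu.-integrable setT (EFin \o (fun x => c * f x)).
  by move=> /(integrableZl measurableT c).
have iZD (f g : T -> R) : mu.-integrable setT (EFin \o f) ->
    mu.-integrable setT (EFin \o g) ->
    mu.-integrable setT (EFin \o (fun x => f x + g x)).
  by move=> ? ?; rewrite (_ : _ \o _ = ((EFin \o f) \+ (EFin \o g))%E)//; exact: integrableD.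
rewrite /J -!RintegralZl// -RintegralD//; [|exact: iZ..].
rewrite -RintegralD//; [|by apply: iZD; exact: iZ|exact: iZ].
apply: le_Rintegral => //; first by apply: (iZD) => /=; [apply: (iZD)|]; exact: (iZ).
  by apply: ipsi; exact: ad_mid.
by move=> x _; exact: psi_mid.
Qed.


Let r k : R := 2^-1 ^+ k.
Let r0 k : 0 < r k. Proof. by rewrite exprn_gt0. Qed.
Let rS k : r k.+1 = 2^-1 * r k. Proof. exact: exprS. Qed.
Let r1 k : r k <= 1. Proof. by rewrite exprn_ile1//; lra. Qed.

Let rintE (f : T -> R) : mu.-integrable setT (EFin \o f) ->
  (\int[mu]_x (f x)%:E = (\int[mu]_x f x)%:E)%E.
Proof. by move=> iF; rewrite fineK//; exact: (integrable_fin_num measurableT iF). Qed.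

(** From L^2(v) to L^1(v), through |D| <= D^2 / r + r with r = 2^-k. *)
Let int_increment F F' (k : nat) (j : 'I_n) :
  admissible F -> admissible F' -> SJ - eps k < J F -> SJ - eps k.+1 < J F' ->
  (\int[mu]_x (v x * `|F' j x - F j x|)%:E <= (10 / (2 ^ k.+1)%:R)%:E)%E.
Proof.
move=> adF adF' JF JF'.
set D := fun j x => F' j x - F j x.
have mD i : measurable_fun setT (D i).
  by apply: measurable_funB; [exact: mK (adF' i)|exact: mK (adF i)].
have iD : mu.-integrable setT (EFin \o (fun x => a * v x * sq D x)).
  apply: (@ivsq _ (b + b)) => // i x.
  by apply: le_trans (ler_normB _ _) _; apply: lerD; exact: Kabs.
have JD : \int[mu]_x (a * v x * sq D x) <= 4 * eps k.
  have := J_mid adF adF'; rewrite -/D.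
  have : eps k.+1 <= eps k.
    rewrite /eps -/(r _) -/(r _) ler_wpM2l ?(ltW a0)// lerXn2r ?nnegrE ?(ltW (r0 _))//.
    by rewrite rS; have := r0 k; lra.
  by set I := Rintegral _ _ _; move: JF JF'; lra.
have ia : 0 <= (r k)^-1 / a.
  by rewrite divr_ge0 ?invr_ge0// ltW.
have avsq0 x : 0 <= a * v x * sq D x.
  by rewrite mulr_ge0// mulr_ge0// ltW.
apply: (@le_trans _ _ (\int[mu]_x (((r k)^-1 / a)%:E * (a * v x * sq D x)%:E +
    (r k)%:E * (v x)%:E))%E).
  apply: ge0_le_integral => //.
  - by move=> x _; rewrite lee_fin mulr_ge0// ltW.
  - apply/measurable_EFinP; apply: measurable_funM => //.
    by apply: measurableT_comp => //; exact: mD.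
  - apply/measurable_EFinP; apply: measurable_funD; apply: measurable_funM => //.
    by apply: measurable_funM; [exact: measurable_funM|exact: msq].
  - move=> x _; rewrite -!EFinM -EFinD lee_fin.
    have -> : (r k)^-1 / a * (a * v x * sq D x) + r k * v x =
        v x * ((r k)^-1 * sq D x + r k) by field; rewrite !gt_eqF ?r0.
    rewrite ler_wpM2l ?(ltW (v0 x))//.
    apply: (@le_trans _ _ ((r k)^-1 * D j x ^+ 2 + r k)); last first.
      rewrite lerD2r ler_wpM2l ?invr_ge0 ?(ltW (r0 k))//.
      by rewrite /sq (bigD1 j)//= lerDl sumr_ge0// => i _; exact: sqr_ge0.
    rewrite -/(D j x) -(@ler_pM2l _ (r k))// mulrDr mulrA divff ?gt_eqF// mul1r.
    rewrite -[D j x ^+ 2]real_normK ?num_real//.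
    have := sqr_ge0 (`|D j x| - r k); have := mulr_ge0 (ltW (r0 k)) (normr_ge0 (D j x)).
    by rewrite sqrrB !expr2; lra.
rewrite ge0_integralD//; last 4 first.
- by move=> x _; rewrite -EFinM lee_fin (mulr_ge0 ia (avsq0 x)).
- apply/measurable_EFinP; apply: measurable_funM => //.
  by apply: measurable_funM; [exact: measurable_funM|exact: msq].
- by move=> x _; rewrite -EFinM lee_fin mulr_ge0// ltW.
- by apply/measurable_EFinP; apply: measurable_funM.
rewrite !ge0_integralZl_EFin//; last 5 first.
- by move=> x _; rewrite lee_fin ltW.
- exact/measurable_EFinP.
- exact: ltW.
- by move=> x _; rewrite lee_fin avsq0.
- by apply/measurable_EFinP; apply: measurable_funM; [exact: measurable_funM|exact: msq].
rewrite (rintE iD) (_ : 10 / _ = (r k)^-1 / a * (4 * eps k) + r k * 1); last first.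
  rewrite /eps -/(r k) natrX exprS invfM -exprVn -/(r k).
  by field; rewrite !gt_eqF ?r0.
rewrite EFinD !EFinM; apply: leeD; apply: lee_wpmul2l => //; rewrite ?lee_fin//.
exact: ltW.
Qed.

Let ae_limit (F : nat -> 'I_n -> T -> R) :
  (forall k, admissible (F k) /\ SJ - eps k < J (F k)) ->
  {ae mu, forall x, forall j, cvgn (fun k => F k j x)}.
Proof.
move=> HF; apply: filter_forall => j.
apply: (ae_cvg_summable_increments mv v0).
  by move=> k; exact: mK ((HF k).1 j).
apply: le_lt_trans (ltry 10).
apply: le_trans (epsilon_trick0 xpredT (ler0n R 10)).
apply: lee_nneseries => k _; first move=> _.
  by apply: integral_ge0 => x _; rewrite lee_fin mulr_ge0// ltW.
by have [? ?] := HF k; have [? ?] := HF k.+1; exact: int_increment.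
Qed.


Let D0 : R := 2 * n%:R * (2 + A1 + b ^+ 2).

(** The competitor: the j0-th function is moved towards F0 by the fraction s. *)
Let comp (F : 'I_n -> T -> R) (j0 : 'I_n) (F0 : T -> R) (s : R) j x : R :=
  if j == j0 then (1 - s) * F j x + s * F0 x else F j x.

Let ad_comp F j0 F0 s : admissible F -> K j0 F0 -> 0 <= s <= 1 ->
  admissible (comp F j0 F0 s).
Proof.
move=> adF KF0 s01 j; rewrite /comp; case: eqVneq => [->|_]; last exact: adF.
exact: Kconv.
Qed.

(** The difference quotient of the main term, up to the factor 1 / n; it tends to
    g_(j0) F0 as s tends to 0. *)
Let quot F j0 (F0 : T -> R) s x : R :=
  G x * P F x * (F0 x / (F j0 x + h x + s * F0 x)).

Let quot0 F j0 F0 s x : admissible F -> K j0 F0 -> 0 <= s -> 0 <= quot F j0 F0 s x.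
Proof.
move=> adF KF0 s0; have /andP[F00 _] := Kb KF0 x.
have z0 := Fh0 adF j0 x; have sF := mulr_ge0 s0 F00.
by rewrite mulr_ge0 ?(mulr_ge0 (G0 x) (P0 F x))// divr_ge0//; lra.
Qed.

Let mquot F j0 F0 s : admissible F -> K j0 F0 -> 0 <= s ->
  measurable_fun setT (quot F j0 F0 s).
Proof.
move=> adF KF0 s0; apply: measurable_funM.
  by apply: mGP => j; exact: mK (adF j).
apply: measurable_funM; first exact: mK KF0.
apply: measurable_funV.
  apply: measurable_funD; first by apply: measurable_funD; [exact: mK (adF j0)|].
  by apply: measurable_funM => //; exact: mK KF0.
move=> x; have /andP[F00 _] := Kb KF0 x.
by have z0 := Fh0 adF j0 x; have sF := mulr_ge0 s0 F00; lra.
Qed.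

(** First variation before passing to the limit. The left-hand side is nonnegative
    for every s > 0, as Fatou's lemma requires; the price is the loss of
    s (G P F), which comes from shrinking F_j0 + h by the factor 1 - s. *)
Let psi_comp F j0 F0 s x : admissible F -> K j0 F0 -> 0 < s <= 2^-1 ->
  s / (2 * n%:R) * quot F j0 F0 s x <=
  psi (comp F j0 F0 s) x - psi F x + (s * (G x * P F x) + s * (a * b ^+ 2) * v x).
Proof.
move=> adF KF0 /andP[s0 s12].
have /andP[F00 F0b] := Kb KF0 x; have z0 := Fh0 adF j0 x.
have /andP[Fj0 Fjb] := Kb (adF j0) x.
have nn0 : 0 < n%:R :> R by rewrite ltr0n.
set z := F j0 x + h x in z0 *; pose u := F0 x / z.
have u0 : 0 <= u by rewrite divr_ge0// ltW.
have su0 : 0 <= s * u by rewrite mulr_ge0// ltW.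
(* The competitor plus h dominates w_j (F_j + h), whose geometric mean is known. *)
pose w (j : 'I_n) : R := if j == j0 then (1 - s) * (1 + s * u) else 1.
have w0 j : 0 <= w j.
  by rewrite /w; case: ifP => // _; rewrite mulr_ge0//; lra.
have zF : z * u = F0 x by rewrite /u mulrC divfK// gt_eqF.
have Pcomp : (1 - s) * (1 + s * u / (n%:R * (1 + s * u))) * P F x <=
    P (comp F j0 F0 s) x.
  apply: (@le_trans _ _ (gmean (fun j => w j * (F j x + h x)))); last first.
    apply: le_gmean => j; rewrite (mulr_ge0 (w0 j) (ltW (Fh0 adF j x)))/=.
    rewrite /w /comp; case: eqVneq => [->|_]; last by rewrite mul1r.
    rewrite -/z -mulrA [_ * z]mulrC mulrDr mulr1 mulrCA zF.
    have := mulr_ge0 (ltW s0) (ltW (h0 x)).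
    have := mulr_ge0 (mulr_ge0 (ltW s0) (ltW s0)) F00.
    by rewrite /z; lra.
  rewrite gmeanM//; last by move=> j; exact/ltW/Fh0.
  rewrite -/(P F x) ler_wpM2r//.
  have -> : gmean w = ((1 - s) * (1 + s * u)) `^ n%:R^-1.
    rewrite /gmean (bigD1 j0)//= big1 => [|j /negPf jj0].
      by rewrite mulr1 /w eqxx.
    by rewrite /w jj0 powR1.
  rewrite powRM; [|lra..]; apply: ler_pM.
  - by lra.
  - by rewrite addr_ge0// divr_ge0// mulr_ge0//; lra.
  - by apply: ger1_powR; [apply/andP; split; lra|rewrite invf_le1// ler1n].
  - exact: powR_rootD1_ge.
have sq_comp : sq (comp F j0 F0 s) x <= sq F x + s * b ^+ 2.
  rewrite /sq (bigD1 j0)//= [in leRHS](bigD1 j0)//= {1}/comp eqxx.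
  rewrite (eq_bigr (fun j => F j x ^+ 2)); last first.
    by move=> j /negPf jj0; rewrite /comp jj0.
  have : F0 x ^+ 2 <= b ^+ 2 by rewrite lerXn2r// nnegrE// (le_trans F00).
  move/(ler_wpM2l (ltW s0)).
  have : 0 <= s * (1 - s) * (F j0 x - F0 x) ^+ 2.
    by rewrite mulr_ge0 ?sqr_ge0// mulr_ge0//; lra.
  have := mulr_ge0 (ltW s0) (sqr_ge0 (F j0 x)).
  set Z := \sum_(_ < _ | _) _; set b' := b ^+ 2.
  have -> : ((1 - s) * F j0 x + s * F0 x) ^+ 2 = (1 - s) * F j0 x ^+ 2 +
    s * F0 x ^+ 2 - s * (1 - s) * (F j0 x - F0 x) ^+ 2 by ring.
  by set y := s * (1 - s) * _; lra.
have GP0 := mulr_ge0 (G0 x) (P0 F x).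
have GPc := ler_wpM2l (G0 x) Pcomp.
have av0 : 0 <= a * v x by rewrite mulr_ge0// ltW.
have avsq := ler_wpM2l av0 sq_comp.
have quotE : quot F j0 F0 s x = G x * P F x * (u / (1 + s * u)).
  rewrite /quot -/z /u; congr (_ * _); field.
  by rewrite !gt_eqF//; have := mulr_ge0 (ltW s0) F00; lra.
have q0 : 0 <= G x * P F x * (u / (1 + s * u)).
  by rewrite mulr_ge0// divr_ge0//; lra.
rewrite quotE.
have -> : s / (2 * n%:R) * (G x * P F x * (u / (1 + s * u))) =
  2^-1 * (s / n%:R * (G x * P F x * (u / (1 + s * u)))).
  by rewrite invfM; ring.
have s2 : 0 <= 2^-1 - s by lra.
have := ler_wpM2l s2 (mulr_ge0 (divr_ge0 (ltW s0) (ltW nn0)) q0).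
move: GPc; rewrite (_ : G x * ((1 - s) * _ * _) = (1 - s) * (G x * P F x) +
  (1 - s) * (s / n%:R * (G x * P F x * (u / (1 + s * u))))); last first.
  by rewrite invfM; ring.
rewrite /psi; set X := s / n%:R * _; set Y := G x * P F x in GP0 *.
set p := G x * P (comp _ _ _ _) x; move: avsq.
rewrite (_ : a * v x * (sq F x + s * b ^+ 2) =
  a * v x * sq F x + s * (a * b ^+ 2) * v x); last by ring.
set c := a * v x * sq (comp _ _ _ _) x; set e := a * v x * sq F x.
by set q := _ * v x => ce Yp; rewrite mulr0; lra.
Qed.


Let intv_le1 : \int[mu]_x v x <= 1.
Proof. by rewrite -lee_fin -rintE. Qed.

(** With s = 2^-(k+1) and an error 4^-k in the supremum, dividing by s leaves a
    bound which does not depend on k. *)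
Let int_quot F k j0 F0 : admissible F -> SJ - eps k < J F -> K j0 F0 ->
  (\int[mu]_x (quot F j0 F0 (r k.+1) x)%:E <= (D0 * a)%:E)%E.
Proof.
move=> adF JF KF0; set s := r k.+1.
have s0 : 0 < s by exact: r0.
have s12 : s <= 2^-1 by rewrite /s rS; have := r1 k; lra.
have s01 : 0 <= s <= 1 by apply/andP; split; lra.
have adC := ad_comp adF KF0 s01.
have nn0 : 0 < n%:R :> R by rewrite ltr0n.
pose c := s / (2 * n%:R).
have c0 : 0 < c by rewrite divr_gt0// mulr_gt0.
have iF := ipsi adF; have iC := ipsi adC; have iG := iGP adF.
have iZ (f : T -> R) (e : R) : mu.-integrable setT (EFin \o f) ->
    mu.-integrable setT (EFin \o (fun x => e * f x)).
  by move=> /(integrableZl measurableT e).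
have iD (f g : T -> R) : mu.-integrable setT (EFin \o f) ->
    mu.-integrable setT (EFin \o g) ->
    mu.-integrable setT (EFin \o (fun x => f x + g x)).
  by move=> ? ?; rewrite (_ : _ \o _ = ((EFin \o f) \+ (EFin \o g))%E)//; exact: integrableD.
have iB (f g : T -> R) : mu.-integrable setT (EFin \o f) ->
    mu.-integrable setT (EFin \o g) ->
    mu.-integrable setT (EFin \o (fun x => f x - g x)).
  by move=> ? ?; rewrite (_ : _ \o _ = ((EFin \o f) \- (EFin \o g))%E)//; exact: integrableB.
pose rhs x := psi (comp F j0 F0 s) x - psi F x +
  (s * (G x * P F x) + s * (a * b ^+ 2) * v x).
have iGs := iZ (fun x => G x * P F x) s iG.
have ivs := iZ v (s * (a * b ^+ 2)) iv.
have iDD := iD _ _ iGs ivs.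
have irhs : mu.-integrable setT (EFin \o rhs).
  by apply: (iD); [exact: (iB)|exact: iDD].
have rhs_le : \int[mu]_x rhs x <= s * (a * (2 + A1 + b ^+ 2)).
  have -> : \int[mu]_x rhs x = J (comp F j0 F0 s) - J F +
      (s * (\int[mu]_x (G x * P F x)) + s * (a * b ^+ 2) * \int[mu]_x v x).
    rewrite -(RintegralZl (f := fun x => G x * P F x) _ measurableT iG).
    rewrite -(RintegralZl _ measurableT iv) -(RintegralD measurableT iGs ivs).
    by rewrite /J -RintegralB// -(RintegralD measurableT (iB _ _ iC iF) iDD).
  have GPle : \int[mu]_x (G x * P F x) <= A1 * a.
    by rewrite -lee_fin -rintE//; exact: intGP.
  have := J_sup adC; rewrite /J => JC.
  have eks : eps k <= s * (2 * a).
    rewrite /s rS /eps -/(r k) expr2.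
    have -> : 2^-1 * r k * (2 * a) = a * (r k * 1) by field.
    by rewrite ler_pM2l// ler_wpM2l// ltW.
  have := ler_wpM2l (ltW s0) GPle.
  have ab0 : 0 <= s * (a * b ^+ 2).
    by rewrite (mulr_ge0 (ltW s0))// mulr_ge0 ?sqr_ge0// ltW.
  have := ler_wpM2l ab0 intv_le1.
  move: JF JC; rewrite /J; set x1 := Rintegral _ _ _; set x2 := Rintegral _ _ _.
  set x3 := Rintegral _ _ v; set x4 := Rintegral _ _ (fun x => G x * _).
  by rewrite mulr1; lra.
rewrite -(@lee_pmul2l _ c%:E)// ?lte_fin//.
rewrite -ge0_integralZl_EFin//; last 3 first.
- by move=> x _; rewrite lee_fin quot0// ltW.
- by apply/measurable_EFinP; apply: mquot => //; exact: ltW.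
- exact: ltW.
apply: (@le_trans _ _ (\int[mu]_x (rhs x)%:E)%E).
  apply: ge0_le_integral => //.
  - by move=> x _; rewrite -EFinM lee_fin mulr_ge0 ?(ltW c0)// quot0// ltW.
  - apply/measurable_EFinP; apply: measurable_funM => //.
    by apply: mquot => //; exact: ltW.
  - exact: (measurable_int mu irhs).
  - move=> x _; rewrite -EFinM lee_fin; apply: psi_comp => //.
    by rewrite s0 s12.
rewrite rintE// -EFinM lee_fin; apply: le_trans rhs_le _.
rewrite /c /D0 le_eqVlt; apply/orP; left; apply/eqP.
by rewrite invfM; field; rewrite gt_eqF.
Qed.

(** The weights are the ones that the first variation produces at the limit L of a
    maximising sequence. Their geometric mean is G at every point because the
    factors L_j + h are positive; the sequence is used instead of a maximiser, as
    L may fall outside of the K j. *)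
Lemma factorisation_weighted : exists g : 'I_n -> T -> R,
  [/\ forall j, measurable_fun setT (g j), forall j x, 0 <= g j x,
      forall x, gmean (g^~ x) = G x &
      forall j F0, K j F0 ->
        (\int[mu]_x (g j x * F0 x)%:E <= (D0 * a)%:E)%E].
Proof.
have [F HF] := maximising.
have adF k := (HF k).1.
(* The absolute value makes L nonnegative also where the sequence diverges. *)
pose L j x := `| limn_sup (fun k => F k j x)|.
have L0 j x : 0 <= L j x by exact: normr_ge0.
have mL j : measurable_fun setT (L j).
  apply: measurableT_comp => //; apply: measurable_fun_limn_sup => [x _|x _|k].
  - by exists b => _ [k _ <-]; have /andP[] := Kb (adF k j) x.
  - by exists 0 => _ [k _ <-]; have /andP[] := Kb (adF k j) x.
  - exact: mK (adF k j).
have Lh j x : 0 < L j x + h x by rewrite ltr_wpDl.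
pose g j x := G x * P L x * (L j x + h x)^-1.
have g0 j x : 0 <= g j x by rewrite mulr_ge0 ?invr_ge0 ?(ltW (Lh j x))// mulr_ge0.
have mg j : measurable_fun setT (g j).
  apply: measurable_funM; first exact: mGP.
  by apply: measurable_funV => //; exact: measurable_funD.
exists g; split => // [x|j F0 KF0].
  have PL0 : 0 < P L x by exact: gmean_gt0.
  have c0 : 0 <= G x * P L x by rewrite mulr_ge0.
  have : gmean (fun _ : 'I_n => G x * P L x) = G x * P L x.
    exact: gmean_cst.
  rewrite (_ : (fun _ : 'I_n => _) = (fun j => g j x * (L j x + h x))); last first.
    by apply/funext => j; rewrite /g divfK// gt_eqF.
  rewrite gmeanM//; last by move=> j; exact: ltW.
  by rewrite -/(P L x) => /mulIf; apply; rewrite gt_eqF.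
pose q k x : \bar R := (quot (F k) j F0 (r k.+1) x)%:E.
have q0 k x : (0 <= q k x)%E by rewrite lee_fin quot0// ltW.
have mq k : measurable_fun setT (q k).
  by apply/measurable_EFinP; apply: mquot => //; exact: ltW.
have qlim : {ae mu, forall x, setT x -> (g j x * F0 x)%:E = limn_einf (q ^~ x)}.
  apply: filterS (ae_limit HF) => x Fcv _.
  have FL i : (fun k => F k i x : R^o) @ \oo --> (L i x : R^o).
    have Fl := Fcv i; rewrite /L cvg_limn_supE// ger0_norm//.
    by apply: limr_ge => //; near=> k; have /andP[] := Kb (adF k i) x.
  have rcv : (fun k => r k.+1 : R^o) @ \oo --> (0 : R^o).
    have : (fun k => r k : R^o) @ \oo --> (0 : R^o).
      by apply: cvg_expr; rewrite ger0_norm//; lra.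
    by rewrite -(cvg_shiftS r).
  suff qc : (fun k => quot (F k) j F0 (r k.+1) x : R^o) @ \oo --> (g j x * F0 x : R^o).
    have /cvg_limn_einf_sup[-> _]// : q ^~ x @ \oo --> (g j x * F0 x)%:E.
    by apply/fine_cvgP; split; [exact: nearW|exact: qc].
  have FhL i : (fun k => F k i x + h x : R^o) @ \oo --> (L i x + h x : R^o).
    by apply: cvgD => //; exact: cvg_cst.
  rewrite /quot /g -mulrA [_^-1 * _]mulrC.
  apply: cvgM.
    apply: cvgM; first exact: cvg_cst.
    exact: cvg_gmean.
  apply: cvgM; first exact: cvg_cst.
  apply: cvgV; first by rewrite gt_eqF.
  rewrite -[X in _ --> X]addr0; apply: cvgD => //.
  rewrite -[X in _ --> X](mul0r (F0 x)); apply: cvgM => //; exact: cvg_cst.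
rewrite (ae_eq_integral (fun x => limn_einf (q ^~ x)))//; last 2 first.
- by apply/measurable_EFinP; apply: measurable_funM => //; exact: mK KF0.
- rewrite (_ : (fun x => _) = -%E \o (fun x => limn_esup (-%E \o q ^~ x))).
    apply: measurableT_comp => //; apply: measurable_fun_limn_esup => k.
    exact: measurableT_comp.
  apply/funext => x /=; rewrite -limn_einfN; congr limn_einf.
  by apply/funext => k; rewrite [RHS]oppeK.
apply: le_trans (fatou mu measurableT mq (fun k x _ => q0 k x)) _.
rewrite limn_einf_lim; apply: lime_le; first exact: is_cvg_einfs.
apply: nearW => k; apply: (@le_trans _ _ (\int[mu]_x q k x)%E).
  by apply: ereal_inf_lbound; exists k => /=.
by have [? ?] := HF k; exact: int_quot.
Unshelve. all: by end_near.
Qed.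

End factorisation.

(** * Random signs and Khintchine's inequality *)

Section signed_sums.

(** All the sums of the entries of s with signs, one for each choice of signs: a
    random sum of the entries is a uniformly chosen member of this list. *)
Fixpoint signed_sums (V : zmodType) (s : seq V) : seq V :=
  if s is v :: s' then
    [seq y + v | y <- signed_sums s'] ++ [seq y - v | y <- signed_sums s']
  else [:: 0].

Lemma size_signed_sums (V : zmodType) (s : seq V) :
  size (signed_sums s) = (2 ^ size s)%N.
Proof.
by elim: s => //= v s IH; rewrite size_cat !size_map IH expnS mul2n addnn.
Qed.

Section closed.
Variables (V : zmodType) (S : set V).
Hypotheses (S0 : S 0) (SD : forall x y, S x -> S y -> S (x + y)).
Hypothesis SB : forall x y, S x -> S y -> S (x - y).

Lemma signed_sums_closed (s : seq V) : (forall v, v \in s -> S v) ->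
  forall y, y \in signed_sums s -> S y.
Proof.
elim: s => [|v s IH] sS y /=; first by rewrite inE => /eqP ->.
have {}IH := IH (fun w ws => sS w (mem_behead (s := v :: s) ws)).
have Sv : S v by apply: sS; rewrite mem_head.
by rewrite mem_cat => /orP[] /mapP[z /IH Sz ->]; [exact: SD|exact: SB].
Qed.

Lemma map_signed_sums (W : zmodType) (L : V -> W) (s : seq V) :
  L 0 = 0 -> (forall x y, S x -> S y -> L (x + y) = L x + L y) ->
  (forall x y, S x -> S y -> L (x - y) = L x - L y) ->
  (forall v, v \in s -> S v) ->
  map L (signed_sums s) = signed_sums (map L s).
Proof.
move=> L0 LD LB; elim: s => [|v s IH] sS /=; first by rewrite L0.
have sS' w : w \in s -> S w by move=> ws; apply: sS; rewrite mem_behead.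
have Sv : S v by apply: sS; rewrite mem_head.
rewrite map_cat -!map_comp -IH// -!map_comp; congr (_ ++ _).
- apply/eq_in_map => y ys /=; apply: LD => //.
  exact: signed_sums_closed ys.
- apply/eq_in_map => y ys /=; apply: LB => //.
  exact: signed_sums_closed ys.
Qed.

(** Orthogonality of random signs, for any Q which obeys the parallelogram law. *)
Lemma sum_signed_sums (R : realType) (Q : V -> R) (s : seq V) :
  Q 0 = 0 ->
  (forall x y, S x -> S y -> Q (x + y) + Q (x - y) = 2 * (Q x + Q y)) ->
  (forall v, v \in s -> S v) ->
  \sum_(y <- signed_sums s) Q y = 2 ^+ size s * \sum_(v <- s) Q v.
Proof.
move=> Q0 QD; elim: s => [|v s IH] sS /=; first by rewrite big_seq1 big_nil mulr0.
have sS' w : w \in s -> S w by move=> ws; apply: sS; rewrite mem_behead.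
have Sv : S v by apply: sS; rewrite mem_head.
rewrite big_cat/= !big_map -big_split/= big_seq.
rewrite (eq_bigr (fun y => 2 * (Q y + Q v))); last first.
  by move=> y ys; apply: QD => //; exact: signed_sums_closed ys.
rewrite -big_seq -mulr_sumr big_split/= IH// big_const_seq count_predT.
rewrite size_signed_sums iter_addr_0 big_cons exprS -[Q v *+ _]mulr_natr natrX.
ring.
Qed.

End closed.
End signed_sums.

Section khintchine.
Variable R : realType.
Implicit Types (z w : R[i]) (s : seq R[i]).

Definition sqmod (z : R[i]) : R := complex.Re z ^+ 2 + complex.Im z ^+ 2.

Lemma sqmod_ge0 z : 0 <= sqmod z.
Proof. by rewrite addr_ge0// sqr_ge0. Qed.

Lemma sqmodE z : cmodulus z ^+ 2 = sqmod z.
Proof. by case: z => x y; rewrite /cmodulus /= sqr_sqrtr// addr_ge0// sqr_ge0. Qed.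

Lemma sqmod0 : sqmod 0 = 0.
Proof. by rewrite /sqmod /= expr0n/= addr0. Qed.

Lemma sqmod_parallelogram z w :
  sqmod (z + w) + sqmod (z - w) = 2 * (sqmod z + sqmod w).
Proof. by case: z w => [a b] [c d]; rewrite /sqmod /=; ring. Qed.

Lemma sqmod_fourth z w : sqmod (z + w) ^+ 2 + sqmod (z - w) ^+ 2 <=
  2 * (sqmod z ^+ 2 + 6 * (sqmod z * sqmod w) + sqmod w ^+ 2).
Proof.
case: z w => [a b] [c d]; rewrite /sqmod /= -subr_ge0.
rewrite (_ : _ - _ = 8 * (a * d - b * c) ^+ 2); last by ring.
by rewrite mulr_ge0// sqr_ge0.
Qed.

Lemma sum_sqmod_signed_sums s :
  \sum_(y <- signed_sums s) sqmod y = 2 ^+ size s * \sum_(z <- s) sqmod z.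
Proof.
apply: (@sum_signed_sums _ setT) => //; first exact: sqmod0.
by move=> x y _ _; exact: sqmod_parallelogram.
Qed.

(** Adding one more sign reduces to 3 A^2 + 6 A B + B^2 <= 3 (A + B)^2. *)
Lemma fourth_moment_signed_sums s :
  \sum_(y <- signed_sums s) sqmod y ^+ 2 <=
  3 * 2 ^+ size s * (\sum_(z <- s) sqmod z) ^+ 2.
Proof.
elim: s => [|v s IH] /=.
  by rewrite big_seq1 big_nil sqmod0 expr0n/= mulr0.
rewrite big_cat/= !big_map -big_split/= big_cons.
apply: (@le_trans _ _ (\sum_(y <- signed_sums s)
    2 * (sqmod y ^+ 2 + 6 * (sqmod y * sqmod v) + sqmod v ^+ 2))).
  by apply: ler_sum => y _; exact: sqmod_fourth.
set A := \sum_(z <- s) sqmod z in IH *.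
rewrite -mulr_sumr !big_split/= -mulr_sumr -mulr_suml sum_sqmod_signed_sums -/A.
rewrite big_const_seq count_predT size_signed_sums iter_addr_0.
rewrite -[_ ^+ 2 *+ _]mulr_natr natrX [2 ^+ (size s).+1]exprS; move: IH.
set X := \sum_(_ <- _) _; set N := 2 ^+ size s.
move=> XA; have N0 : 0 <= N * sqmod v ^+ 2 by apply: mulr_ge0; [exact: exprn_ge0|exact: sqr_ge0].
rewrite (_ : 3 * (2 * N) * _ = 2 * (3 * N * A ^+ 2 + 6 * (N * A * sqmod v) +
  3 * (N * sqmod v ^+ 2))); last by ring.
rewrite [sqmod v ^+ 2 * N]mulrC.
lra.
Qed.

(** The lower Khintchine inequality with exponent 2/n. For the squared modulus,
    normalised to have mean 1, the second moment is at most 3, so averaging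
    t - t^2 / 4 <= t^(1/n) leaves at least 1/4. *)
Lemma khintchine_root s n : (0 < n)%N ->
  (\sum_(z <- s) sqmod z) `^ n%:R^-1 <=
  4 / 2 ^+ size s * \sum_(y <- signed_sums s) sqmod y `^ n%:R^-1.
Proof.
move=> n0; set a := \sum_(z <- s) _; set q : R := n%:R^-1.
have a0 : 0 <= a by apply: sumr_ge0 => z _; exact: sqmod_ge0.
have N0 : 0 < 2 ^+ size s :> R by exact: exprn_gt0.
have [->|an0] := eqVneq a 0.
  rewrite powR0 /q; last by rewrite invr_eq0 pnatr_eq0 -lt0n.
  apply: mulr_ge0; first by apply: divr_ge0 => //; exact: ltW.
  by apply: sumr_ge0 => y _; exact: powR_ge0.
have {an0}a0 : 0 < a by rewrite lt_neqAle eq_sym an0.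
have q01 : 0 <= q <= 1 by rewrite invr_ge0 ler0n /q invf_le1 ?ltr0n// ler1n.
have E y : sqmod y `^ q = a `^ q * (sqmod y / a) `^ q.
  by rewrite -powRM ?divr_ge0 ?sqmod_ge0 ?(ltW a0)// mulrC divfK// gt_eqF.
under eq_bigr do rewrite E.
rewrite -mulr_sumr mulrCA -[leLHS]mulr1 ler_wpM2l ?powR_ge0//.
rewrite mulrAC ler_pdivlMr// mul1r.
apply: (@le_trans _ _ (4 * \sum_(y <- signed_sums s)
    (sqmod y / a - (sqmod y / a) ^+ 2 / 4))); last first.
  rewrite ler_wpM2l//; apply: ler_sum => y _; apply: parabola_le_powR => //.
  by rewrite divr_ge0 ?sqmod_ge0// ltW.
rewrite sumrB -mulr_suml sum_sqmod_signed_sums -/a mulfK ?gt_eqF//.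
rewrite -mulr_suml (eq_bigr (fun y => sqmod y ^+ 2 * (a ^+ 2)^-1)); last first.
  by move=> y _; rewrite expr_div_n.
rewrite -mulr_suml.
have : (\sum_(y <- signed_sums s) sqmod y ^+ 2) / a ^+ 2 <= 3 * 2 ^+ size s.
  by rewrite ler_pdivrMr ?exprn_gt0//; exact: fourth_moment_signed_sums.
lra.
Qed.

End khintchine.

(** Distributivity over lists of unequal lengths; the indices range over one finite
    type so that the product of the sums is a sum over finite functions. *)
Lemma prod_sum_seq (R : realType) (V : zmodType) n (L : 'I_n -> seq V)
    (M := \max_(j < n) size (L j)) (F : 'I_n -> V -> R) :
  \prod_(j < n) \sum_(y <- L j) F j y =
  \sum_(f in family (fun j => [pred i : 'I_M | (i < size (L j))%N]))
    \prod_(j < n) F j (nth 0 (L j) (f j)).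
Proof.
under eq_bigr => j _.
  rewrite (big_nth 0) big_mkord.
  rewrite (big_ord_widen M (fun i => F j (nth 0 (L j) i))); last exact: (leq_bigmax j).
  over.
by rewrite bigA_distr_big_dep.
Qed.

(** * Factorisation for quadratic energies of linear operators *)

(** S j is the domain of the linear operator L j, and Q j plays the part of the
    square of a Hilbert norm on it. *)
Section quadratic.
Context d (X : measurableType d) (R : realType).
Variable mu : {sigma_finite_measure set X -> \bar R}.
Variables (m : nat).
Local Notation n := m.+1.
Variables (V : lmodType R) (S : 'I_n -> set V) (Q : 'I_n -> V -> R).
Variables (L : 'I_n -> V -> X -> R[i]) (b A a : R) (G : X -> R).
Hypotheses (S0 : forall j, S j 0).
Hypothesis SD : forall j x y, S j x -> S j y -> S j (x + y).
Hypothesis SZ : forall j (c : R) x, S j x -> S j (c *: x).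
Hypothesis LD : forall j x y t, S j x -> S j y ->
  L j (x + y) t = L j x t + L j y t.
Hypothesis LZ : forall j (c : R) x t, S j x ->
  L j (c *: x) t = (c%:C)%C * L j x t.
Hypothesis mL : forall j x, S j x -> measurable_fun setT (fun t => sqmod (L j x t)).
Hypothesis Q_ge0 : forall j x, 0 <= Q j x.
Hypothesis QP : forall j x y, S j x -> S j y ->
  Q j (x + y) + Q j (x - y) = 2 * (Q j x + Q j y).
Hypothesis QZ : forall j (c : R) x, S j x -> Q j (c *: x) = c ^+ 2 * Q j x.
Hypothesis b1 : 1 <= b.
Hypothesis Lb : forall j x t, S j x -> Q j x <= 1 -> sqmod (L j x t) <= b.
Hypotheses (a0 : 0 < a) (A0 : 0 <= A).
Hypotheses (mG : measurable_fun setT G) (G0 : forall x, 0 <= G x).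
Hypothesis normG : (\int[mu]_x (G x ^+ n)%:E <= (a ^+ n)%:E)%E.
Hypothesis bound : forall f : 'I_n -> V, (forall j, S j (f j)) ->
  (\int[mu]_x (G x * gmean (fun j => sqmod (L j (f j) x)))%:E <=
   (A * a * \prod_(j < n) Q j (f j) `^ n%:R^-1)%:E)%E.

Let SB j x y : S j x -> S j y -> S j (x - y).
Proof. by move=> Sx Sy; rewrite -scaleN1r; apply: SD => //; exact: SZ. Qed.

Let LB j x y t : S j x -> S j y -> L j (x - y) t = L j x t - L j y t.
Proof.
move=> Sx Sy; rewrite -scaleN1r LD ?LZ//; last exact: SZ.
by rewrite rmorphN1 mulN1r.
Qed.

Let L0 j t : L j 0 t = 0.
Proof. by rewrite -(scale0r (0 : V)) LZ// rmorph0 mul0r. Qed.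

Let Q0 j : Q j 0 = 0.
Proof. by rewrite -(scale0r (0 : V)) QZ// expr0n/= mul0r. Qed.

Let sqLZ j c x t : S j x -> sqmod (L j (c *: x) t) = c ^+ 2 * sqmod (L j x t).
Proof.
move=> Sx; rewrite LZ//; case: (L j x t) => u w; rewrite /sqmod /=; ring.
Qed.

Let sqLb j x t : S j x -> sqmod (L j x t) <= b * Q j x.
Proof.
move=> Sx; apply/ler_addgt0Pr => e e0; have b0 : 0 < b by have := b1; lra.
pose p := Q j x + e / b.
have p0 : 0 < p by rewrite ltr_wpDl// divr_gt0.
have := Lb t (SZ (Num.sqrt p)^-1 Sx); rewrite QZ// sqLZ// exprVn sqr_sqrtr ?(ltW p0)//.
rewrite mulrC ler_pdivrMr// mul1r [_^-1 * _]mulrC ler_pdivrMr//.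
rewrite /p mulrDr [b * (e / b)]mulrC divfK ?gt_eqF//; apply.
by rewrite lerDl divr_ge0// ltW.
Qed.

(** The convex hull of the functions |L f|^2 with Q f <= 1: the weights of a convex
    combination are absorbed in the f by homogeneity. *)
Definition energies j : set (X -> R) := [set F | exists s : seq V,
  [/\ forall f, f \in s -> S j f, \sum_(f <- s) Q j f <= 1 &
      F = fun t => \sum_(f <- s) sqmod (L j f t)]].

Let energies0 j : energies j (fun=> 0).
Proof.
by exists [::]; split; rewrite ?big_nil//; apply/funext => t; rewrite big_nil.
Qed.

Let measurable_energies j F : energies j F -> measurable_fun setT F.
Proof.
move=> [s [sS _ ->]]; elim: s sS => [|f s IH] sS.
  by under eq_fun do rewrite big_nil; exact: measurable_cst.
under eq_fun do rewrite big_cons; apply: measurable_funD.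
  by apply: mL; apply: sS; rewrite mem_head.
by apply: IH => g gs; apply: sS; rewrite mem_behead.
Qed.

Let energies_bounded j F : energies j F -> forall t, 0 <= F t <= b.
Proof.
move=> [s [sS Qs ->]] t; rewrite sumr_ge0/=; last by move=> f _; exact: sqmod_ge0.
rewrite big_seq; apply: (@le_trans _ _ (\sum_(f <- s | f \in s) b * Q j f)).
  by apply: ler_sum => f fs; apply: sqLb; exact: sS.
rewrite -mulr_sumr -big_seq ler_piMr//; by have := b1; lra.
Qed.

Let energies_convex j F F' (s : R) : energies j F -> energies j F' ->
  0 <= s <= 1 -> energies j (fun x => (1 - s) * F x + s * F' x).
Proof.
move=> [l [lS Ql ->]] [l' [lS' Ql' ->]] /andP[s0 s1].
have s10 : 0 <= 1 - s by lra.
exists ([seq Num.sqrt (1 - s) *: f | f <- l] ++ [seq Num.sqrt s *: f | f <- l']).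
split.
- by move=> f; rewrite mem_cat => /orP[] /mapP[g gl ->]; apply: SZ; auto.
- rewrite big_cat/= !big_map big_seq [X in _ + X]big_seq.
  rewrite (eq_bigr (fun f => (1 - s) * Q j f)); last first.
    by move=> f fl; rewrite QZ ?sqr_sqrtr; auto.
  rewrite [X in _ + X](eq_bigr (fun f => s * Q j f)); last first.
    by move=> f fl; rewrite QZ ?sqr_sqrtr; auto.
  rewrite -!big_seq -!mulr_sumr.
  have := ler_wpM2l s10 Ql; have := ler_wpM2l s0 Ql'.
  by rewrite !mulr1; lra.
- apply/funext => t; rewrite big_cat/= !big_map [in RHS]big_seq.
  rewrite [X in _ = _ + X]big_seq; congr (_ + _); rewrite mulr_sumr big_seq;
    by apply: eq_bigr => f fl; rewrite sqLZ ?sqr_sqrtr; auto.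
Qed.

(** Randomisation. Khintchine's inequality replaces each F_j by an average of
    |L_j f|^2 over random sums f; independence of the signs for different j lets
    the product be expanded, the hypothesis applies to each term, and averaging
    Q f over the signs gives back the sum of the Q. *)
Let energies_bound (F : 'I_n -> X -> R) : (forall j, energies j (F j)) ->
  (\int[mu]_x (G x * gmean (F^~ x))%:E <= ((8 ^+ n * A) * a)%:E)%E.
Proof.
move=> eF; have /choice[s sF] := eF.
have sS j : forall f, f \in s j -> S j f by have [] := sF j.
have sQ j : \sum_(f <- s j) Q j f <= 1 by have [] := sF j.
have FE j : F j = fun t => \sum_(f <- s j) sqmod (L j f t) by have [] := sF j.
pose l j := signed_sums (s j).
have lS j f : f \in l j -> S j f.
  exact: (signed_sums_closed (@S0 j) (@SD j) (@SB j) (@sS j)).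
pose N j : R := 2 ^+ size (s j).
have N0 j : 0 < N j by exact: exprn_gt0.
have c0 j : 0 <= 4 / N j by rewrite divr_ge0// ltW.
have Fle j t : F j t `^ n%:R^-1 <=
    4 / N j * \sum_(f <- l j) sqmod (L j f t) `^ n%:R^-1.
  rewrite FE; have := khintchine_root (map (L j ^~ t) (s j)) (ltn0Sn m).
  rewrite -(map_signed_sums (@S0 j) (@SD j) (@SB j) (L0 j t)
    (fun x y => @LD j x y t) (fun x y => @LB j x y t) (@sS j)).
  by rewrite !big_map size_map.
pose M := \max_(j < n) size (l j).
pose fam := family (fun j : 'I_n => [pred i : 'I_M | (i < size (l j))%N]).
pose pick (e : {ffun 'I_n -> 'I_M}) j := nth 0 (l j) (e j).
have pickS e j : S j (pick e j).
  rewrite /pick; have [ej|ej] := ltnP (e j) (size (l j)); last by rewrite nth_default.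
  by apply: lS; exact: mem_nth.
pose H e x := G x * gmean (fun j => sqmod (L j (pick e j) x)).
have H0 e x : 0 <= H e x by rewrite mulr_ge0// gmean_ge0.
have mH e : measurable_fun setT (H e).
  by apply: measurable_funM => //; apply: measurable_gmean => j; exact: mL.
pose c := \prod_(j < n) (4 / N j).
have cc0 : 0 <= c by exact: prodr_ge0.
apply: (@le_trans _ _ (\int[mu]_x (c%:E * \sum_(e in fam) (H e x)%:E))%E).
  apply: ge0_le_integral => //.
  - by move=> x _; rewrite lee_fin mulr_ge0// gmean_ge0.
  - apply/measurable_EFinP; apply: measurable_funM => //.
    by apply: measurable_gmean => j; exact: measurable_energies (eF j).
  - apply: measurable_funeM; under eq_fun do rewrite -big_filter.
    by apply: emeasurable_sum => e; exact/measurable_EFinP.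
  - move=> x _; rewrite sumEFin -EFinM lee_fin /H -mulr_sumr mulrCA ler_wpM2l//.
    rewrite /c /gmean -(prod_sum_seq l (fun j f => sqmod (L j f x) `^ n%:R^-1)).
    rewrite -big_split/=; apply: ler_prod => j _; rewrite powR_ge0/=.
    exact: Fle.
rewrite ge0_integralZl//; last 2 first.
- under eq_fun do rewrite -big_filter.
  by apply: emeasurable_sum => e; exact/measurable_EFinP.
- by move=> x _; apply: sume_ge0 => e _; rewrite lee_fin.
under eq_integral do rewrite -big_filter.
rewrite ge0_integral_sum//; last 2 first.
- by move=> e; exact/measurable_EFinP.
- by move=> e x _; rewrite lee_fin.
rewrite big_filter.
apply: (@le_trans _ _ (c%:E * \sum_(e in fam)
    (A * a * \prod_(j < n) Q j (pick e j) `^ n%:R^-1)%:E)%E).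
  apply: lee_wpmul2l; first by rewrite lee_fin.
  by apply: lee_sum => e _; exact: bound.
rewrite sumEFin -EFinM lee_fin -mulr_sumr.
rewrite -(prod_sum_seq l (fun j f => Q j f `^ n%:R^-1)).
rewrite mulrCA -[leRHS]mulrA [leRHS]mulrC ler_wpM2l//.
  by rewrite mulr_ge0// ltW.
rewrite /c -big_split/= -[n in leRHS](card_ord n) -prodr_const.
apply: ler_prod => j _; apply/andP; split.
  by rewrite mulr_ge0// sumr_ge0// => f _; exact: powR_ge0.
have q01 : 0 <= (n%:R^-1 : R) <= 1 by rewrite invr_ge0 ler0n invf_le1 ?ltr0n// ler1n.
rewrite mulrAC ler_pdivrMr//.
apply: (@le_trans _ _ (4 * \sum_(f <- l j) (1 + Q j f))).
  by rewrite ler_wpM2l//; apply: ler_sum => f _; exact: powR_le_D1.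
rewrite big_split/= big_const_seq count_predT size_signed_sums iter_addr_0.
rewrite (sum_signed_sums (@S0 j) (@SD j) (@SB j) (Q0 j) (@QP j) (@sS j)).
rewrite natrX -/(N j); have := ler_wpM2l (ltW (N0 j)) (sQ j).
by rewrite mulr1; lra.
Qed.

(** [factorisation_weighted] for the energies, rescaled from Q f <= 1 to all f. *)
Lemma quadratic_factorisation : exists g : 'I_n -> X -> R,
  [/\ forall j, measurable_fun setT (g j), forall j x, 0 <= g j x,
      forall x, gmean (g^~ x) = G x &
      forall j f, S j f -> (\int[mu]_x (g j x * sqmod (L j f x))%:E <=
        (2 * n%:R * (2 + (8 ^+ n * A + 2 * (b + 2) ^+ n) + b ^+ 2) * a * Q j f)%:E)%E].
Proof.
have [v [mv v01 intv]] := sigma_finite_weight mu.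
have A80 : 0 <= 8 ^+ n * A by rewrite mulr_ge0// exprn_ge0.
have [g [mg g0 gG gK]] := factorisation_weighted a0 b1 mG G0 normG mv v01 intv
  energies0 measurable_energies energies_bounded energies_convex energies_bound.
exists g; split => // j f Sf; apply/lee_addgt0Pr => e e0.
set D := 2 * _ * _ * a in gK *.
have D0 : 0 < D.
  rewrite mulr_gt0// mulr_gt0//.
  have : 0 <= (b + 2) ^+ n by apply: exprn_ge0; have := b1; lra.
  by have := sqr_ge0 b; have := A80; lra.
(* Q j f may vanish, so it is increased slightly before dividing by it. *)
pose p := Q j f + e / D; have p0 : 0 < p by rewrite ltr_wpDl// divr_gt0.
have sp : (Num.sqrt p)^-1 ^+ 2 = p^-1 by rewrite exprVn sqr_sqrtr// ltW.
pose F0 t := \sum_(h <- [:: (Num.sqrt p)^-1 *: f]) sqmod (L j h t).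
have KF0 : energies j F0.
  exists [:: (Num.sqrt p)^-1 *: f]; split => //.
  - by move=> h; rewrite inE => /eqP ->; exact: SZ.
  - rewrite big_seq1 QZ// sp mulrC ler_pdivrMr// mul1r.
    by rewrite lerDl divr_ge0// ltW.
have F0E t : sqmod (L j f t) = p * F0 t.
  by rewrite /F0 big_seq1 sqLZ// sp mulrA divff ?mul1r// gt_eqF.
under eq_integral do rewrite F0E mulrCA EFinM.
have mF0 := measurable_energies KF0.
rewrite ge0_integralZl_EFin//; last 3 first.
- by move=> x _; rewrite lee_fin mulr_ge0//; have /andP[] := energies_bounded KF0 x.
- by apply/measurable_EFinP; exact: measurable_funM.
- exact: ltW.
apply: (@le_trans _ _ (p%:E * D%:E)%E).
  by rewrite lee_pmul2l// ?lte_fin//; exact: gK.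
by rewrite -EFinM -EFinD lee_fin /p mulrDl divfK ?gt_eqF// [_ * D]mulrC.
Qed.

End quadratic.

(** * Borel sets and smooth parametrisations *)

Section borel_sets.
Variables (R : realType) (m : nat).

Let side (p : 'rV[rat]_m * nat) i : set (measurableTypeR R) :=
  [set` `[ratr (p.1 ord0 i) - p.2.+1%:R^-1, ratr (p.1 ord0 i) + p.2.+1%:R^-1]].

Let box p := [set x : 'rV[R]_m | forall i, side p i (x ord0 i)].

(** The topology of the row vectors has a countable base of rational boxes, and
    boxes belong to the sigma-algebra generated by the coordinates. *)
Lemma open_measurable_rV (A : set 'rV[R]_m) : open A -> measurable A.
Proof.
move=> oA.
suff -> : A = \bigcup_(p : 'rV[rat]_m * nat)
    (if `[< box p `<=` A >] then box p else set0).
  apply: countable_bigcupT_measurable; first exact: countableP.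
  move=> p; case: ifP => _ //; apply: (measurable_rV_box (A := side p)) => i.
  exact: measurable_itv.
apply/seteqP; split => [x Ax|x [p _]]; last first.
  by case: asboolP => // pA; exact: pA.
have /nbhs_ballP[e /= e0 eA] : nbhs x A by exact: open_nbhs_nbhs.
have [N _ Ne] : exists2 N, True & N.+1%:R^-1 < e / 2.
  have [N _ /(_ N (leqnn N)) /= H] := near_infty_natSinv_lt (PosNum (divr_gt0 e0 (@ltr0n R 2))).
  by exists N.
pose r : R := N.+1%:R^-1; have r0 : 0 < r by rewrite invr_gt0.
rewrite -/r in Ne.
have /choice[q Hq] (i : 'I_m) : exists q : rat,
    ratr q \in `]x ord0 i - r, x ord0 i + r[.
  by apply: rat_in_itvoo; move: (x ord0 i) => y; lra.
pose p : 'rV[rat]_m * nat := (\row_i q i, N).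
have pA : box p `<=` A.
  move=> y ypB; apply: eA; split => // i j; rewrite !ord1.
  have := ypB j; rewrite /side/= in_itv/= mxE -/r => /andP[y1 y2].
  have := Hq j; rewrite in_itv/= => /andP[q1 q2].
  by rewrite /ball/= ltr_norml; apply/andP; split; lra.
exists p => //; case: asboolP => // _ i; rewrite /side/= in_itv/= mxE -/r.
by have := Hq i; rewrite in_itv/= => /andP[q1 q2]; apply/andP; split; lra.
Qed.

Lemma bounded_rV_lty (U : set 'rV[R]_m) : bounded_set U -> measurable U ->
  (lebesgue_rV R m U < +oo)%E.
Proof.
move=> [M [Mreal HM]] mU.
have {HM} := HM (`|M| + 1) _; set B := `|M| + 1 => HB.
have {}HB : forall x, U x -> `|x| <= B.
  by move=> x Ux; apply: HB => //; rewrite /B; have := ler_norm M; lra.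
pose A (_ : 'I_m) : set (measurableTypeR R) := [set` `[- B, B]].
have mA i : measurable (A i) by exact: measurable_itv.
apply: (@le_lt_trans _ _ (lebesgue_rV R m [set x | forall i, A i (x ord0 i)])).
  apply: le_measure; rewrite ?inE//; first exact: measurable_rV_box.
  move=> x Ux i; rewrite /A/= in_itv/= -ler_norml.
  apply: le_trans (HB x Ux).
  rewrite {2}/Num.norm/= mx_normrE.
  exact: (@le_bigmax _ _ _ 0 (fun i : 'I_1 * 'I_m => `|x i.1 i.2|) (ord0, i)).
rewrite lebesgue_rV_box//; suff : (\prod_(i < m) lebesgue_measure (A i))%E \is a fin_num.
  by rewrite fin_numE ltey => /andP[].
apply: (big_ind (fun y : \bar R => y \is a fin_num)) => //.
  by move=> *; exact: fin_numM.
by move=> i _; rewrite lebesgue_measure_itv/=; case: ifP.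
Qed.

End borel_sets.

Section smooth_measurable.
Variables (R : realType) (m n : nat).

(** Continuity at the points of an open W containing U suffices: the points of W
    where a coordinate exceeds a given number form an open set. *)
Lemma smooth_measurable (U : set 'rV[R]_m) (Gamma : 'rV[R]_m -> 'rV[R]_n) i :
  measurable U -> smooth U Gamma ->
  measurable_fun U (fun t => Gamma t ord0 i : measurableTypeR R).
Proof.
move=> mU [W [oW UW Wk]]; have cG := Wk 0%N.
apply: (measurability _ (RGenOInfty.measurableE R)) => //.
move=> _ [_ [a ->] <-].
rewrite (_ : _ `&` _ = U `&` [set t | W t /\ a < Gamma t ord0 i]); last first.
  apply/seteqP; split => t /= [Ut]; rewrite in_itv/= andbT.
    by move=> ta; split => //; split => //; exact: UW.
  by move=> [_ ta].
apply: measurableI => //; apply: open_measurable_rV.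
rewrite openE => t [Wt ta]; apply: filterI.
  by move: oW; rewrite openE; exact.
have : (fun s => Gamma s ord0 i) @ t --> (Gamma t ord0 i : R^o).
  exact: (cvg_comp _ _ (cG t Wt) (@coord_continuous _ _ _ ord0 i _)).
by move/(@cvgr_gt _ _ _ _ _ _) => /(_ _ ta).
Qed.

End smooth_measurable.

(** * The extension operator on square-integrable functions *)

Lemma measurable_fine_fubini d1 d2 (X : measurableType d1) (Y : measurableType d2)
    (R : realType) (lam : {sigma_finite_measure set Y -> \bar R}) (k : X * Y -> R) :
  measurable_fun setT k ->
  measurable_fun setT (fun x => \int[lam]_y k (x, y)).
Proof.
move=> mk; have mEk : measurable_fun setT (EFin \o k) by exact/measurable_EFinP.
rewrite (_ : (fun _ => _) = fine \o (fun x =>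
    fubini_F lam (EFin \o k)^\+ x - fubini_F lam (EFin \o k)^\- x)%E); last first.
  apply/funext => x; rewrite /Rintegral integralE; congr fine.
  by rewrite /fubini_F; congr (_ + - _)%E; apply: eq_integral => y _; rewrite ?funeposE ?funenegE.
apply: measurableT_comp => //; apply: emeasurable_funB.
- by apply: measurable_fun_fubini_tonelli_F => //; exact: measurable_funepos.
- by apply: measurable_fun_fubini_tonelli_F => //; exact: measurable_funeneg.
Qed.

Lemma cmodulus_ge0 (R : realType) (z : R[i]) : 0 <= cmodulus z.
Proof. by case: z => u w; exact: sqrtr_ge0. Qed.

Section extension.
Variables (R : realType) (m n : nat) (U : set 'rV[R]_m).
Variable Gamma : 'rV[R]_m -> 'rV[R]_n.
Local Notation lam := (lebesgue_rV R m).
Local Notation V := ('rV[R]_m -> Rcomplex R).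
Implicit Types f g : V.

Lemma L2normE f :
  L2norm U f = ((\int[lam]_(t in U) (sqmod (f t))%:E) `^ 2^-1)%E.
Proof.
rewrite /L2norm unlock [in RHS]integral_mkcond; congr (_ `^ _)%E.
apply: eq_integral => t _; rewrite /= !patchE; case: ifP => _ /=.
  by rewrite ger0_norm ?cmodulus_ge0// powR_mulrn ?cmodulus_ge0// sqmodE.
by rewrite normr0 powR0.
Qed.

Lemma L2P f : L2 U f <-> cmeasurable_fun U f /\
  (\int[lam]_(t in U) (sqmod (f t))%:E < +oo)%E.
Proof.
rewrite /L2 L2normE; split=> -[mf fy]; split=> //; last exact: poweR_lty.
by apply: lty_poweRy fy.
Qed.

Hypothesis mU : measurable U.
Hypothesis Ufin : (lam U < +oo)%E.
Hypothesis mGamma : forall i,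
  measurable_fun U (fun t => Gamma t ord0 i : measurableTypeR R).

Lemma measurable_sqmod f : cmeasurable_fun U f ->
  measurable_fun U (fun t => sqmod (f t)).
Proof.
by move=> [mr mi]; apply: measurable_funD; exact: measurable_funX.
Qed.

(** The square of the L^2 norm, as a real number; junk value 0 if that is infinite. *)
Definition mass f : R := \int[lam]_(t in U) sqmod (f t).

Lemma mass_ge0 f : 0 <= mass f.
Proof. by apply: Rintegral_ge0 => t _; exact: sqmod_ge0. Qed.

Lemma L2_integrable f : L2 U f ->
  lam.-integrable U (EFin \o (fun t => sqmod (f t))).
Proof.
move=> /L2P[mf fy]; apply/integrableP; split.
  by apply/measurable_EFinP; exact: measurable_sqmod.
by under eq_integral do rewrite gee0_abs ?lee_fin ?sqmod_ge0//.
Qed.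

Lemma massE f : L2 U f -> (mass f)%:E = (\int[lam]_(t in U) (sqmod (f t))%:E)%E.
Proof.
by move=> /L2_integrable fi; rewrite fineK//; exact: (integrable_fin_num mU fi).
Qed.

Lemma L2norm_mass f : L2 U f -> L2norm U f = (mass f `^ 2^-1)%:E.
Proof. by move=> fL; rewrite L2normE -massE. Qed.

Let modul (x : 'rV[R]_n) f t : R[i] := expi (2 * pi * dotr x (Gamma t)) * f t.

Let sqmod_modul x f t : sqmod (modul x f t) = sqmod (f t).
Proof.
rewrite /modul; case: (f t) => u w; rewrite /sqmod/=.
set c := cos _; set s := sin _; have cs : c ^+ 2 + s ^+ 2 = 1 by exact: cos2Dsin2.
rewrite (_ : _ + _ = (c ^+ 2 + s ^+ 2) * (u ^+ 2 + w ^+ 2)); last by ring.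
by rewrite cs mul1r.
Qed.

Let measurable_phase x :
  measurable_fun U (fun t => 2 * pi * dotr x (Gamma t) : measurableTypeR R).
Proof.
apply: measurable_funM => //; rewrite /dotr; apply: measurable_sum => i.
by apply: measurable_funM => //; exact: mGamma.
Qed.

Let measurable_cos (R' : realType) : measurable_fun setT (@cos R').
Proof. by apply: continuous_measurable_fun; exact: continuous_cos. Qed.

Let measurable_sin (R' : realType) : measurable_fun setT (@sin R').
Proof. by apply: continuous_measurable_fun; exact: continuous_sin. Qed.

Lemma cmeasurable_modul x f : cmeasurable_fun U f -> cmeasurable_fun U (modul x f).
Proof.
move=> [mr mi].
have mc : measurable_fun U (fun t => cos (2 * pi * dotr x (Gamma t))).
  exact: (measurableT_comp (measurable_cos (R' := R)) (measurable_phase x)).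
have ms : measurable_fun U (fun t => sin (2 * pi * dotr x (Gamma t))).
  exact: (measurableT_comp (measurable_sin (R' := R)) (measurable_phase x)).
split.
- rewrite (_ : (fun _ => _) = fun t => cos (2 * pi * dotr x (Gamma t)) * complex.Re (f t)
    - sin (2 * pi * dotr x (Gamma t)) * complex.Im (f t)); last first.
    by apply/funext => t; rewrite /modul; case: (f t).
  by apply: measurable_funB; exact: measurable_funM.
- rewrite (_ : (fun _ => _) = fun t => cos (2 * pi * dotr x (Gamma t)) * complex.Im (f t)
    + sin (2 * pi * dotr x (Gamma t)) * complex.Re (f t)); last first.
    by apply/funext => t; rewrite /modul; case: (f t).
  by apply: measurable_funD; exact: measurable_funM.
Qed.

(** On a set of finite measure this makes a square-integrable function integrable
    without Hoelder's inequality. *)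
Let abs_le_sq (u w : R) : `|u| <= 1 + (u ^+ 2 + w ^+ 2).
Proof.
rewrite -[u ^+ 2]real_normK ?num_real//.
have := sqr_ge0 (`|u| - 2^-1); have := sqr_ge0 w.
have -> : (`|u| - 2^-1) ^+ 2 = `|u| ^+ 2 - `|u| + 4^-1 by field.
by lra.
Qed.

Let dominated_integrable f (h : 'rV[R]_m -> R) : L2 U f -> measurable_fun U h ->
  (forall t, `|h t| <= 1 + sqmod (f t)) ->
  lam.-integrable U (EFin \o h) /\ `|\int[lam]_(t in U) h t| <= fine (lam U) + mass f.
Proof.
move=> fL mh hf; have fi := L2_integrable fL.
have i1 : lam.-integrable U (EFin \o cst 1).
  apply: measurable_bounded_integrable => //; exists 1; split => // M M1 t _ /=.
  by rewrite normr1 ltW.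
have i2 : lam.-integrable U (EFin \o (fun t => cst 1 t + sqmod (f t))).
  exact: (integrableD mU i1 fi).
have ih : lam.-integrable U (EFin \o h).
  apply: le_integrable i2 => //; first exact/measurable_EFinP.
  move=> t _ /=; rewrite lee_fin; apply: le_trans (hf t) _; exact: ler_norm.
split => //; apply: le_trans (le_normr_Rintegral mU ih) _.
have -> : fine (lam U) + mass f = \int[lam]_(t in U) (cst 1 t + sqmod (f t)).
  by rewrite RintegralD// Rintegral_cst// mul1r.
by apply: le_Rintegral => //; exact: integrable_norm.
Qed.

Let modul_integrable x f : L2 U f ->
  [/\ lam.-integrable U (EFin \o (fun t => complex.Re (modul x f t))),
      lam.-integrable U (EFin \o (fun t => complex.Im (modul x f t))),
      `|\int[lam]_(t in U) complex.Re (modul x f t)| <= fine (lam U) + mass f &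
      `|\int[lam]_(t in U) complex.Im (modul x f t)| <= fine (lam U) + mass f].
Proof.
move=> fL; have [mf _] := (L2P f).1 fL.
have [mr mi] := cmeasurable_modul x mf.
have [] := dominated_integrable fL mr.
  by move=> t; rewrite -(sqmod_modul x f) /sqmod; exact: abs_le_sq.
have [] := dominated_integrable fL mi.
  by move=> t; rewrite -(sqmod_modul x f) /sqmod [_ ^+ 2 + _]addrC; exact: abs_le_sq.
by [].
Qed.

Local Notation E := (extension_op U Gamma).

(** The integrand of E f has the same modulus as f, and |f| <= 1 + |f|^2. *)
Lemma extension_bound f x : L2 U f ->
  sqmod (E f x) <= 2 * (fine (lam U) + mass f) ^+ 2.
Proof.
move=> fL; have [_ _ br bi] := modul_integrable x fL.
rewrite [leRHS]mulr_natl [leRHS]mulr2n /sqmod /= -/(modul x f).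
have sq_le y : `|y| <= fine (lam U) + mass f -> y ^+ 2 <= (fine (lam U) + mass f) ^+ 2.
  move=> yb; rewrite -[y ^+ 2]real_normK ?num_real//.
  by rewrite lerXn2r ?nnegrE// (le_trans _ yb).
by apply: lerD; exact: sq_le.
Qed.

Lemma extensionD f g x : L2 U f -> L2 U g -> E (f + g) x = E f x + E g x.
Proof.
move=> fL gL; have [fr fi _ _] := modul_integrable x fL.
have [gr gi _ _] := modul_integrable x gL.
apply/eqP; rewrite eq_complex /=; apply/andP; split; apply/eqP.
- rewrite -RintegralD//; apply: eq_Rintegral => t _.
  by rewrite addrfctE /modul mulrDr; case: (_ * f t); case: (_ * g t).
- rewrite -RintegralD//; apply: eq_Rintegral => t _.
  by rewrite addrfctE /modul mulrDr; case: (_ * f t); case: (_ * g t).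
Qed.

Lemma extensionZ (c : R) f x : L2 U f -> E (c *: f) x = (c%:C)%C * E f x.
Proof.
move=> fL; have [fr fi _ _] := modul_integrable x fL.
apply/eqP; rewrite eq_complex /= !mul0r addr0 subr0; apply/andP; split; apply/eqP.
- rewrite -RintegralZl//; apply: eq_Rintegral => t _.
  rewrite /modul; change ((c *: f) t) with (c *: f t).
  by case: (f t) => u w /=; ring.
- rewrite -RintegralZl//; apply: eq_Rintegral => t _.
  rewrite /modul; change ((c *: f) t) with (c *: f t).
  by case: (f t) => u w /=; ring.
Qed.

(** Fubini: extended by 0 outside of U, the integrand is jointly measurable in the
    frequency x and the parameter t. *)
Lemma measurable_extension f : cmeasurable_fun U f ->
  measurable_fun setT (fun x => sqmod (E f x)).
Proof.
move=> [mr mi].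
pose G' i := (fun t => Gamma t ord0 i : measurableTypeR R) \_ U.
pose fr := (fun t => complex.Re (f t) : measurableTypeR R) \_ U.
pose fi := (fun t => complex.Im (f t) : measurableTypeR R) \_ U.
have mG' i : measurable_fun setT (G' i).
  by apply/(measurable_restrictT _ mU); exact: mGamma.
have mfr : measurable_fun setT fr by exact/(measurable_restrictT _ mU).
have mfi : measurable_fun setT fi by exact/(measurable_restrictT _ mU).
pose th (p : 'rV[R]_n * 'rV[R]_m) : R := 2 * pi * \sum_(i < n) p.1 ord0 i * G' i p.2.
have mth : measurable_fun setT th.
  apply: measurable_funM => //; apply: measurable_sum => i; apply: measurable_funM.
    by apply: (measurableT_comp (measurable_rV_coord i)).
  exact: (measurableT_comp (mG' i)).
have mc : measurable_fun setT (fun p => cos (th p)).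
  exact: (measurableT_comp (measurable_cos (R' := R)) mth).
have ms : measurable_fun setT (fun p => sin (th p)).
  exact: (measurableT_comp (measurable_sin (R' := R)) mth).
have mfr2 : measurable_fun setT (fun p : 'rV[R]_n * 'rV[R]_m => fr p.2).
  exact: (measurableT_comp mfr).
have mfi2 : measurable_fun setT (fun p : 'rV[R]_n * 'rV[R]_m => fi p.2).
  exact: (measurableT_comp mfi).
have thE x t : U t -> th (x, t) = 2 * pi * dotr x (Gamma t).
  move=> Ut; rewrite /th /dotr; congr (_ * _); apply: eq_bigr => i _.
  by rewrite /G' patchE mem_set.
apply: measurable_funD; apply: measurable_funX.
- rewrite (_ : (fun _ => _) = fun x => \int[lam]_t
    (cos (th (x, t)) * fr t - sin (th (x, t)) * fi t)).
    apply: (measurable_fine_fubini lam (k := fun p => cos (th p) * fr p.2 - sin (th p) * fi p.2)).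
    by apply: measurable_funB; exact: measurable_funM.
  apply/funext => x /=; rewrite Rintegral_mkcond; apply: eq_Rintegral => t _.
  rewrite /fr /fi !patchE; case: ifPn => [/set_mem Ut|_]; last by rewrite !mulr0 subr0.
  by rewrite thE//; case: (f t).
- rewrite (_ : (fun _ => _) = fun x => \int[lam]_t
    (cos (th (x, t)) * fi t + sin (th (x, t)) * fr t)).
    apply: (measurable_fine_fubini lam (k := fun p => cos (th p) * fi p.2 + sin (th p) * fr p.2)).
    by apply: measurable_funD; exact: measurable_funM.
  apply/funext => x /=; rewrite Rintegral_mkcond; apply: eq_Rintegral => t _.
  rewrite /fr /fi !patchE; case: ifPn => [/set_mem Ut|_]; last by rewrite !mulr0 addr0.
  by rewrite thE//; case: (f t).
Qed.

Lemma L2_0 : L2 U (0 : V).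
Proof.
apply/L2P; split.
  by split; exact: measurable_cst.
by under eq_integral do rewrite sqmod0; rewrite integral0 ltry.
Qed.

Let sqmodD_le (z w : R[i]) : sqmod (z + w) <= 2 * sqmod z + 2 * sqmod w.
Proof.
have := sqmod_parallelogram z w; have := sqmod_ge0 (z - w); lra.
Qed.

Lemma L2D f g : L2 U f -> L2 U g -> L2 U (f + g).
Proof.
move=> fL gL; have [[fr fi] _] := fL; have [[gr gi] _] := gL.
have mfg : cmeasurable_fun U (f + g).
  split.
    rewrite (_ : (fun _ => _) = fun t => complex.Re (f t) + complex.Re (g t)).
      exact: measurable_funD.
    by apply/funext => t; rewrite addrfctE; case: (f t) => ? ?; case: (g t).
  rewrite (_ : (fun _ => _) = fun t => complex.Im (f t) + complex.Im (g t)).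
    exact: measurable_funD.
  by apply/funext => t; rewrite addrfctE; case: (f t) => ? ?; case: (g t).
apply/L2P; split=> //.
have iF := integrableZl mU 2 (L2_integrable fL).
have iG := integrableZl mU 2 (L2_integrable gL).
have ifg : lam.-integrable U (EFin \o (fun t => sqmod ((f + g) t))).
  apply: (le_integrable mU _ _ (integrableD mU iF iG)).
    by apply/measurable_EFinP; exact: measurable_sqmod.
  move=> t _ /=; rewrite lee_fin !ger0_norm ?sqmod_ge0//.
    exact: sqmodD_le.
  by apply: addr_ge0; apply: mulr_ge0 => //; exact: sqmod_ge0.
move/integrableP : ifg => [_].
by under eq_integral do rewrite /= ger0_norm ?sqmod_ge0//.
Qed.

Let sqmodZ (c : R) (z : Rcomplex R) : sqmod (c *: z) = c ^+ 2 * sqmod z.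
Proof. by case: z => u w; rewrite /sqmod /=; ring. Qed.

Lemma L2Z (c : R) f : L2 U f -> L2 U (c *: f).
Proof.
move=> fL; have [[fr fi] _] := fL; apply/L2P; split.
  split.
    rewrite (_ : (fun _ => _) = fun t => c * complex.Re (f t)); first exact: measurable_funM.
    apply/funext => t; change ((c *: f) t) with (c *: f t).
    by case: (f t).
  rewrite (_ : (fun _ => _) = fun t => c * complex.Im (f t)); first exact: measurable_funM.
  apply/funext => t; change ((c *: f) t) with (c *: f t).
  by case: (f t).
under eq_integral => t _.
  change ((c *: f) t) with (c *: f t); rewrite sqmodZ EFinM; over.
rewrite ge0_integralZl_EFin ?sqr_ge0//; last 2 first.
- by move=> t _; rewrite lee_fin sqmod_ge0.
- by apply/measurable_EFinP; exact: measurable_sqmod.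
by rewrite -massE// -EFinM ltry.
Qed.

Lemma mass_scale (c : R) f : L2 U f -> mass (c *: f) = c ^+ 2 * mass f.
Proof.
move=> fL; rewrite /mass -RintegralZl//; last exact: L2_integrable.
by apply: eq_Rintegral => t _; exact: sqmodZ.
Qed.

Lemma mass_parallelogram f g : L2 U f -> L2 U g ->
  mass (f + g) + mass (f - g) = 2 * (mass f + mass g).
Proof.
move=> fL gL; have L2fB : L2 U (f - g).
  by rewrite -scaleN1r; apply: L2D => //; exact: L2Z.
have If := L2_integrable fL; have Ig := L2_integrable gL.
have IfD := L2_integrable (L2D fL gL); have IfB := L2_integrable L2fB.
rewrite /mass -(RintegralD mU IfD IfB) -(RintegralD mU If Ig) -RintegralZl//; last exact: (integrableD mU If Ig).
apply: eq_Rintegral => t _.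
exact: (sqmod_parallelogram (f t) (g t)).
Qed.

End extension.

(** * From weights to the multilinear bound *)

Lemma Lnorm_ge0_fun d (T : measurableType d) (R : realType)
    (mu : {measure set T -> \bar R}) (r : R) (f : T -> R) : (forall x, 0 <= f x) ->
  ('N[mu]_(r%:E)[EFin \o f] = (\int[mu]_x (f x `^ r)%:E) `^ r^-1)%E.
Proof.
move=> f0; rewrite unlock; congr (_ `^ _)%E; apply: eq_integral => x _ /=.
by rewrite ger0_norm.
Qed.

(** The two ways to write the multilinear product: through moduli, as in the
    bound, and through squared moduli, as in the weighted estimates. *)
Lemma gmean_sqmod (R : realType) n (z : 'I_n -> R[i]) (q : R) :
  (\prod_(j < n) cmodulus (z j) `^ n%:R^-1) `^ (2 * q) =
  gmean (fun j => sqmod (z j)) `^ q.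
Proof.
rewrite powRrM; congr (_ `^ _); rewrite powR_mulrn; last first.
  by apply: prodr_ge0 => j _; exact: powR_ge0.
rewrite -prodrXl; apply: eq_bigr => j _.
by rewrite -sqmodE -!powR_mulrn ?cmodulus_ge0 ?powR_ge0// powRAC.
Qed.

Section multilinear.
Context d (X : measurableType d) (R : realType).
Variable mu : {sigma_finite_measure set X -> \bar R}.
Variable k : nat.
Local Notation n := k.+2.
Local Notation q := (n%:R / (n%:R - 1) : R).

Let q_conj : (n%:R^-1 + q^-1 = 1 :> R).
Proof. by rewrite invf_div mulrBl mulfV ?pnatr_eq0// mul1r addrC subrK. Qed.

Let n1 : 0 < n%:R - 1 :> R.
Proof. by rewrite subr_gt0 ltr1n. Qed.

Let q0 : 0 < q. Proof. by rewrite divr_gt0// ltr0n. Qed.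

(** q is the exponent conjugate to n. *)
Lemma integral_le_Lnorm (G W : X -> R) :
  measurable_fun setT G -> measurable_fun setT W ->
  (forall x, 0 <= G x) -> (forall x, 0 <= W x) ->
  (\int[mu]_x (G x * W x)%:E <=
   'N[mu]_(n%:R%:E)[EFin \o G] * (\int[mu]_x (W x `^ q)%:E) `^ q^-1)%E.
Proof.
move=> mG mW G0 W0; rewrite -(Lnorm_ge0_fun mu q W0).
have n0 : 0 < n%:R :> R by rewrite ltr0n.
apply: le_trans (hoelder mu mG mW n0 q0 q_conj); rewrite Lnorm1.
rewrite le_eqVlt; apply/orP; left; apply/eqP; apply: eq_integral => x _ /=.
by rewrite ger0_norm// mulr_ge0.
Qed.

(** Duality with the extremal G = W^(1/(n-1)), for which G^n = G W = W^q. Both the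
    restriction to the sets A i of finite measure and the bound b on the h j serve
    to make the integral of G^n finite, so that its n-th root can be divided out. *)
Lemma gmean_norm_le_of_weights (h : 'I_n -> X -> R) (M : 'I_n -> R) (b D : R) :
  (forall j, measurable_fun setT (h j)) -> (forall j x, 0 <= h j x <= b) ->
  0 <= D -> (forall j, 0 <= M j) ->
  (forall G : X -> R, measurable_fun setT G -> (forall x, 0 <= G x) ->
    ('N[mu]_(n%:R%:E)[EFin \o G] < +oo)%E ->
    exists g : 'I_n -> X -> R, [/\ forall j, measurable_fun setT (g j),
      forall j x, 0 <= g j x, {ae mu, forall x, G x <= gmean (g^~ x)} &
      forall j, (\int[mu]_x (h j x * g j x)%:E <=
        D%:E * 'N[mu]_(n%:R%:E)[EFin \o G] * (M j)%:E)%E]) ->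
  ((\int[mu]_x (gmean (h^~ x) `^ q)%:E) `^ q^-1 <= (D * gmean M)%:E)%E.
Proof.
move=> mh hb D0 M0 HG; have h0 j x : 0 <= h j x by have /andP[] := hb j x.
pose W x := gmean (h^~ x).
have W0 x : 0 <= W x by exact: gmean_ge0.
have mW : measurable_fun setT W by exact: measurable_gmean.
have mWq : measurable_fun setT (fun x => W x `^ q).
  exact: (measurableT_comp (measurable_powR _)).
pose b1 : R := gmean (fun _ : 'I_n => b).
have Wb x : W x <= b1 by apply: le_gmean => j; exact: hb.
have n0 : n%:R != 0 :> R by rewrite pnatr_eq0.
have DM0 : 0 <= D * gmean M by rewrite mulr_ge0// gmean_ge0.
suff Wfin : (\int[mu]_x (W x `^ q)%:E <= ((D * gmean M) `^ q)%:E)%E.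
  apply: (@le_trans _ _ (((D * gmean M) `^ q)%:E `^ q^-1)%E).
    apply: gt0_ler_poweR => //; rewrite ?in_itv/= ?leey ?andbT ?lee_fin ?powR_ge0//.
    by apply: integral_ge0 => x _; rewrite lee_fin powR_ge0.
  by rewrite poweR_EFin -powRrM mulfV ?gt_eqF// powRr1.
have [A [UA ndA Afin]] := (sigma_finiteP _ _).1 (sigma_finiteT mu).
have mA i : measurable (A i) by have [] := Afin i.
pose Wq i x := W x `^ q * \1_(A i) x.
have Wq0 i x : 0 <= Wq i x by rewrite mulr_ge0// powR_ge0.
have mWqi i : measurable_fun setT (Wq i).
  by apply: measurable_funM => //; exact/measurable_indicP.
have Wqlim x : (Wq i x)%:E @[i --> \oo] --> (W x `^ q)%:E.
  have [i0 _ Ai0] : (\bigcup_i A i) x by rewrite -UA.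
  apply: cvg_near_cst; near=> i; congr EFin; rewrite /Wq indicE mem_set ?mulr1//.
  have : (i0 <= i)%N by near: i; exact: nbhs_infty_ge.
  by move/ndA/subsetPset; apply.
suff Wqi i : (\int[mu]_x (Wq i x)%:E <= ((D * gmean M) `^ q)%:E)%E.
  have -> : (\int[mu]_x (W x `^ q)%:E = \int[mu]_x (limn_einf (fun i => (Wq i x)%:E)))%E.
    apply: eq_integral => x _.
    by have /cvg_limn_einf_sup[-> _] := Wqlim x.
  apply: le_trans (fatou mu measurableT _ _) _.
  - by move=> i; exact/measurable_EFinP.
  - by move=> i x _; rewrite lee_fin.
  - rewrite limn_einf_lim; apply: lime_le; first exact: is_cvg_einfs.
    apply: nearW => i; apply: (@le_trans _ _ (\int[mu]_x (Wq i x)%:E)%E) => //.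
    by apply: ereal_inf_lbound; exists i => /=.
pose p : R := (n%:R - 1)^-1.
have p0 : 0 < p by rewrite invr_gt0.
pose G x := W x `^ p * \1_(A i) x.
have G0 x : 0 <= G x by rewrite mulr_ge0// powR_ge0.
have mG : measurable_fun setT G.
  apply: measurable_funM; last exact/measurable_indicP.
  exact: (measurableT_comp (measurable_powR _)).
have Gn x : G x `^ n%:R = Wq i x.
  rewrite /G /Wq indicE; case: (_ \in _); last by rewrite !mulr0 powR0.
  by rewrite !mulr1 -powRrM mulrC.
have GW x : G x * W x = Wq i x.
  rewrite /G /Wq mulrAC; congr (_ * _); have -> : q = p + 1.
    by rewrite /p; field; rewrite gt_eqF.
  rewrite powRD ?powRr1//; apply/implyP => /eqP ?.
  by have := p0; lra.
have Ifin : (\int[mu]_x (Wq i x)%:E < +oo)%E.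
  apply: (@le_lt_trans _ _ (\int[mu]_x ((b1 `^ q)%:E * (\1_(A i) x)%:E))%E).
    apply: (@ge0_le_integral _ _ _ mu setT measurableT).
    - by move=> x _; rewrite lee_fin.
    - exact/measurable_EFinP.
    - by apply/measurable_EFinP; apply: measurable_funM; [exact: measurable_cst|exact/measurable_indicP].
    - move=> x _; rewrite -EFinM lee_fin ler_wpM2r//.
      by apply: ge0_ler_powR; rewrite ?nnegrE ?(ltW q0)// gmean_ge0.
  rewrite ge0_integralZl_EFin ?powR_ge0//; last by apply/measurable_EFinP/measurable_indicP.
  rewrite integral_indic// setIT; apply: lte_mul_pinfty => //.
  - by rewrite lee_fin powR_ge0.
  - by have [] := Afin i.
set I := (\int[mu]_x (Wq i x)%:E)%E in Ifin *.
have I0 : (0 <= I)%E by apply: integral_ge0 => x _; rewrite lee_fin.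
have [y Iy] : exists y, I = y%:E by exists (fine I); rewrite fineK// ge0_fin_numE.
have y0 : 0 <= y by rewrite -lee_fin -Iy.
have NG : ('N[mu]_(n%:R%:E)[EFin \o G] = (y `^ n%:R^-1)%:E)%E.
  rewrite Lnorm_ge0_fun//; under eq_integral do rewrite Gn.
  by rewrite -/I Iy poweR_EFin.
have [g [mg g0 Gg gM]] : exists g : 'I_n -> X -> R, [/\ forall j, measurable_fun setT (g j),
      forall j x, 0 <= g j x, {ae mu, forall x, G x <= gmean (g^~ x)} &
      forall j, (\int[mu]_x (h j x * g j x)%:E <=
        (D * y `^ n%:R^-1 * M j)%:E)%E].
  have Gfin : ('N[mu]_(n%:R%:E)[EFin \o G] < +oo)%E by rewrite NG ltry.
  have [g [mg g0 Gg gM]] := HG G mG G0 Gfin.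
  by exists g; split => // j; have := gM j; rewrite NG -!EFinM.
have Ile : y <= D * y `^ n%:R^-1 * gmean M.
  have c0 : 0 <= D * y `^ n%:R^-1 by rewrite mulr_ge0// powR_ge0.
  rewrite -lee_fin -Iy.
  have -> : D * y `^ n%:R^-1 * gmean M = gmean (fun j => D * y `^ n%:R^-1 * M j).
    by rewrite gmeanM// gmean_cst.
  apply: le_trans (gmean_hoelder (mu := mu) (u := fun j x => h j x * g j x) _ _ _ _ gM) => //.
  - apply: ae_ge0_le_integral => //.
    + by move=> x _; rewrite lee_fin.
    + exact/measurable_EFinP.
    + by move=> x _; rewrite lee_fin gmean_ge0.
    + by apply/measurable_EFinP/measurable_gmean => j; exact: measurable_funM.
    + apply: filterS Gg => x Gx _; rewrite lee_fin -GW gmeanM// mulrC.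
      by rewrite ler_wpM2l.
  - by move=> j; exact: measurable_funM.
  - by move=> j x; exact: mulr_ge0.
  - by move=> j; exact: mulr_ge0.
rewrite Iy lee_fin; have [->|yn0] := eqVneq y 0; first exact: powR_ge0.
have {yn0}y0 : 0 < y by rewrite lt_neqAle eq_sym yn0.
have yq : y `^ q^-1 <= D * gmean M.
  have yn : 0 < y `^ n%:R^-1 by exact: powR_gt0.
  rewrite -(ler_pM2l yn) -powRD; last by rewrite (gt_eqF y0)/= implybT.
  by rewrite q_conj powRr1 ?(ltW y0)// mulrCA mulrA.
have -> : y = (y `^ q^-1) `^ q by rewrite -powRrM mulVf ?gt_eqF// powRr1// ltW.
by apply: ge0_ler_powR; rewrite ?nnegrE ?powR_ge0// ltW.
Unshelve. all: by end_near.
Qed.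

End multilinear.

(** * The equivalence *)

Theorem theorem1p8 (R : realType) (n : nat) (n_ge2 : (2 <= n)%N)
    (U : 'I_n -> set 'rV[R]_(n.-1))
    (Gamma : 'I_n -> 'rV[R]_(n.-1) -> 'rV[R]_n)
    (S : 'I_n -> set 'rV[R]_n)
    (U_bounded : forall j, bounded_set (U j))
    (U_measurable : forall j, measurable (U j))
    (Gamma_param : forall j, smooth_parametrisation (U j) (Gamma j) (S j))
    (S_compact : forall j, compact (S j))
    (S_curved : forall j, nonvanishing_curvature (U j) (Gamma j))
    (S_transversal : transverse U Gamma) :
  let mu := lebesgue_rV R n in
  let E j := extension_op (U j) (Gamma j) in
  (exists2 C : R, 0 <= C & forall f : 'I_n -> 'rV[R]_(n.-1) -> R[i],
     (forall j, L2 (U j) (f j)) ->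
     ('N[mu]_((2 * n%:R / (n%:R - 1))%:E)
        [(fun x => (\prod_(j < n) (cmodulus (E j (f j) x)) `^ (n%:R^-1))%:E)]
      <= C%:E * \prod_(j < n) (L2norm (U j) (f j)) `^ (n%:R^-1))%E)
  <->
  (exists2 C : R, 0 <= C & forall G : 'rV[R]_n -> R,
     measurable_fun [set: 'rV[R]_n] (G : _ -> measurableTypeR R) ->
     (forall x, 0 <= G x) ->
     ('N[mu]_(n%:R%:E)[EFin \o G] < +oo)%E ->
     exists g : 'I_n -> 'rV[R]_n -> R,
       [/\ forall j, measurable_fun [set: 'rV[R]_n]
             (g j : _ -> measurableTypeR R),
           forall j x, 0 <= g j x,
           {ae mu, forall x, G x <= \prod_(j < n) (g j x) `^ (n%:R^-1)} &
           forall j (f : 'rV[R]_(n.-1) -> R[i]), L2 (U j) f ->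
             ((\int[mu]_x ((cmodulus (E j f x)) ^+ 2 * g j x)%:E) `^ (2^-1)
              <= C%:E * 'N[mu]_(n%:R%:E)[EFin \o G] `^ (2^-1)
                 * L2norm (U j) f)%E]).
Proof.
move: n_ge2 U Gamma S U_bounded U_measurable Gamma_param S_compact S_curved
  S_transversal.
case: n => [//|[//|k]] _ U Gamma S U_bounded U_measurable Gamma_param _ _ _ mu E.
set N := k.+2.
have Ufin j : (lebesgue_rV R k.+1 (U j) < +oo)%E by exact: bounded_rV_lty.
have mGamma j i : measurable_fun (U j) (fun t => Gamma j t ord0 i : measurableTypeR R).
  by have [smG _ _ _] := Gamma_param j; exact: smooth_measurable.
have mE j f : L2 (U j) f -> measurable_fun setT (fun x => sqmod (E j f x)).
  by move=> [mf _]; exact: measurable_extension.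
have sqrt_mass j f : L2 (U j) f -> L2norm (U j) f = (mass (U j) f `^ 2^-1)%:E.
  by move=> fL; exact: L2norm_mass.
pose q : R := N%:R / (N%:R - 1).
have n1 : 0 < N%:R - 1 :> R by rewrite subr_gt0 ltr1n.
have q0 : 0 < q by rewrite divr_gt0// ltr0n.
have rE : 2 * N%:R / (N%:R - 1) = 2 * q :> R by rewrite mulrA.
pose W (f : 'I_N -> 'rV[R]_k.+1 -> R[i]) x := gmean (fun j => sqmod (E j (f j) x)).
have normE f : ('N[mu]_((2 * N%:R / (N%:R - 1))%:E)
    [(fun x => (\prod_(j < N) (cmodulus (E j (f j) x)) `^ (N%:R^-1))%:E)] =
    ((\int[mu]_x (W f x `^ q)%:E) `^ q^-1) `^ 2^-1)%E.
  rewrite rE (Lnorm_ge0_fun mu (2 * q)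
    (f := fun x => \prod_(j < N) (cmodulus (E j (f j) x)) `^ (N%:R^-1))).
    by under eq_integral do rewrite gmean_sqmod; rewrite invfM mulrC poweRrM.
  by move=> x; apply: prodr_ge0 => j _; exact: powR_ge0.
have prodE f : (forall j, L2 (U j) (f j)) ->
    (\prod_(j < N) (L2norm (U j) (f j)) `^ (N%:R^-1) =
     (gmean (fun j => mass (U j) (f j)) `^ 2^-1)%:E)%E.
  move=> fL; rewrite /gmean.
  have -> : (\prod_(j < N) (L2norm (U j) (f j)) `^ (N%:R^-1) =
      \prod_(j < N) ((mass (U j) (f j) `^ N%:R^-1) `^ 2^-1)%:E)%E.
    by apply: eq_bigr => j _; rewrite sqrt_mass// poweR_EFin powRAC.
  by rewrite prodEFin powR_prod// => j; exact: powR_ge0.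
split=> [[C C0 HC]|[C C0 HC]].
- pose b : R := 1 + \sum_(j < N) 2 * (fine (lebesgue_rV R k.+1 (U j)) + 1) ^+ 2.
  have bge j : 2 * (fine (lebesgue_rV R k.+1 (U j)) + 1) ^+ 2 <= b.
    rewrite /b (bigD1 j)//= addrCA lerDl addr_ge0// sumr_ge0// => i _.
    by rewrite mulr_ge0// sqr_ge0.
  have b1 : 1 <= b.
    by rewrite /b lerDl sumr_ge0// => i _; rewrite mulr_ge0// sqr_ge0.
  pose D : R := 2 * N%:R * (2 + (8 ^+ N * C ^+ 2 + 2 * (b + 2) ^+ N) + b ^+ 2).
  exists (D `^ 2^-1); first exact: powR_ge0.
  move=> G mG G0 Gfin.
  have NG0 : (0 <= 'N[mu]_(N%:R%:E)[EFin \o G])%E by exact: Lnorm_ge0.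
  have [a aE] : exists a, ('N[mu]_(N%:R%:E)[EFin \o G] = a%:E)%E.
    by exists (fine 'N[mu]_(N%:R%:E)[EFin \o G]%E); rewrite fineK// ge0_fin_numE.
  have a0 : 0 <= a by rewrite -lee_fin -aE Lnorm_ge0.
  have Nn0 : N%:R != 0 :> R by rewrite pnatr_eq0.
(* The factorisation scales with the norm a of G, which therefore must be
   positive; a vanishing G has vanishing weights. *)
  rewrite aE; have [az|an0] := eqVneq a 0.
    exists (fun _ _ => 0); split => //.
    + have Gz : ae_eq mu setT (EFin \o G) (cst 0%E).
        apply: (Lnorm_eq0_eq0 (p := N%:R%:E)); [exact/measurable_EFinP| |].
          by rewrite lte_fin ltr0n.
        by rewrite aE az.
      by apply: filterS Gz => x /(_ I) [->]; apply: prodr_ge0 => j _; exact: powR_ge0.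
    + move=> j f fL; under eq_integral do rewrite mulr0.
      rewrite integral0 poweR0r// mule_ge0//; last exact: Lnorm_ge0.
      by rewrite mule_ge0// ?lee_fin ?powR_ge0// poweR_ge0.
  have {an0}a0 : 0 < a by rewrite lt_neqAle eq_sym an0.
  have normG : (\int[mu]_x (G x ^+ N)%:E <= (a ^+ N)%:E)%E.
    have := poweR_Lnorm mu (EFin \o G) Nn0; rewrite aE poweR_EFin powR_mulrn ?(ltW a0)// => ->.
    rewrite le_eqVlt; apply/orP; left; apply/eqP; apply: eq_integral => x _ /=.
    by rewrite ger0_norm// powR_mulrn.
  have bound f : (forall j, L2 (U j) (f j)) ->
      (\int[mu]_x (G x * gmean (fun j => sqmod (E j (f j) x)))%:E <=
       (C ^+ 2 * a * \prod_(j < N) mass (U j) (f j) `^ N%:R^-1)%:E)%E.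
    move=> fL; have mW : measurable_fun setT (W f).
      by apply: measurable_gmean => j; exact: mE.
    have W0 x : 0 <= W f x by exact: gmean_ge0.
    apply: le_trans (integral_le_Lnorm mu k mG mW G0 W0) _. rewrite aE.
    have := HC f fL; rewrite normE prodE// -EFinM.
    set Y := (_ `^ q^-1)%E; have Y0 : (0 <= Y)%E by exact: poweR_ge0.
    have M0 : 0 <= gmean (fun j => mass (U j) (f j)) by exact: gmean_ge0.
    case: Y Y0 => [y| |]//; rewrite ?poweRyr// poweR_EFin !lee_fin => y0.
    by rewrite ler_root2// => yC; rewrite mulrAC [leRHS]mulrC ler_pM2l.
  have Ebound j f x : L2 (U j) f -> mass (U j) f <= 1 -> sqmod (E j f x) <= b.
    move=> fL f1; apply: le_trans (bge j).
    apply: le_trans (extension_bound (U_measurable j) (Ufin j) (@mGamma j) x fL) _.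
    have Uj0 : 0 <= fine (lebesgue_rV R k.+1 (U j)) by exact: fine_ge0.
    rewrite ler_pM2l// lerXn2r ?nnegrE ?addr_ge0 ?mass_ge0//.
    by rewrite lerD2l.
  have [g [mg g0 gG gM]] := quadratic_factorisation (mu := mu)
    (V := 'rV[R]_k.+1 -> Rcomplex R)
    (S := fun j => L2 (U j)) (Q := fun j => mass (U j)) (L := E) (A := C ^+ 2)
    (fun j => @L2_0 R k.+1 (U j))
    (fun j f g => L2D (U_measurable j) (f := f) (g := g))
    (fun j c f => L2Z (U_measurable j) c (f := f))
    (fun j f g x => extensionD (U_measurable j) (Ufin j) (@mGamma j) x (f := f) (g := g))
    (fun j c f x => extensionZ (U_measurable j) (Ufin j) (@mGamma j) c x (f := f))
    (fun j f fL => mE j f fL)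
    (fun j f => mass_ge0 (U j) f)
    (fun j f g => mass_parallelogram (U_measurable j) (f := f) (g := g))
    (fun j c f => mass_scale (U_measurable j) c (f := f))
    b1 Ebound a0 (sqr_ge0 C) mG G0 normG bound.
  exists g; split => //.
    by apply: aeW => x; rewrite -/(gmean _) gG.
  move=> j f fL; have := gM j f fL; rewrite -/D sqrt_mass//.
  under eq_integral do rewrite mulrC -sqmodE.
  set I := integral _ _ _; have I0 : (0 <= I)%E.
    by apply: integral_ge0 => x _; rewrite lee_fin mulr_ge0// sqr_ge0.
  have D0 : 0 <= D.
    have : 0 <= (b + 2) ^+ N by rewrite exprn_ge0//; lra.
    have : 0 <= 8 ^+ N * C ^+ 2 by rewrite mulr_ge0 ?sqr_ge0// exprn_ge0.
    by have := sqr_ge0 b; rewrite /D => *; rewrite mulr_ge0//; lra.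
  case: I I0 => [y| |]//; rewrite !poweR_EFin -!EFinM !lee_fin => y0 yD.
  have Da0 := mulr_ge0 D0 (ltW a0).
  rewrite -(powRM _ D0 (ltW a0)) -(powRM _ Da0 (mass_ge0 _ _)).
  by apply: ge0_ler_powR; rewrite ?nnegrE ?(mulr_ge0 Da0) ?mass_ge0.
- exists C => // f fL; rewrite normE prodE// -EFinM.
  pose b : R := 1 + \sum_(j < N) 2 * (fine (lebesgue_rV R k.+1 (U j)) + mass (U j) (f j)) ^+ 2.
  have Eb j x : 0 <= sqmod (E j (f j) x) <= b.
    rewrite sqmod_ge0/=.
    apply: le_trans (extension_bound (U_measurable j) (Ufin j) (@mGamma j) x (fL j)) _.
    rewrite /b (bigD1 j)//= addrCA lerDl addr_ge0// sumr_ge0// => i _.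
    by rewrite mulr_ge0// sqr_ge0.
  have W_le : ((\int[mu]_x (W f x `^ q)%:E) `^ q^-1 <=
      (C ^+ 2 * gmean (fun j => mass (U j) (f j)))%:E)%E.
    apply: (gmean_norm_le_of_weights (fun j => mE j _ (fL j)) Eb (sqr_ge0 C)).
      by move=> j; exact: mass_ge0.
    move=> G mG G0 Gfin; have [g [mg g0 Gg gC]] := HC G mG G0 Gfin.
    exists g; split => // j; have := gC j _ (fL j); rewrite sqrt_mass//.
    under eq_integral do rewrite sqmodE.
    set I := integral _ _ _; have I0 : (0 <= I)%E.
      by apply: integral_ge0 => x _; rewrite lee_fin mulr_ge0// sqmod_ge0.
    have [a aE] : exists a, ('N[mu]_(N%:R%:E)[EFin \o G] = a%:E)%E.
      by exists (fine 'N[mu]_(N%:R%:E)[EFin \o G]%E); rewrite fineK// ge0_fin_numE ?Lnorm_ge0.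
    have a0 : 0 <= a by rewrite -lee_fin -aE Lnorm_ge0.
    rewrite aE poweR_EFin -!EFinM.
    case: I I0 => [y| |]//; rewrite ?poweRyr// poweR_EFin !lee_fin => y0.
    rewrite -mulrA -powRM ?mass_ge0// ler_root2 ?mulr_ge0 ?mass_ge0//.
    by rewrite mulrA.
  move: W_le; set Y := (_ `^ q^-1)%E; have Y0 : (0 <= Y)%E by exact: poweR_ge0.
  case: Y Y0 => [y| |]//; rewrite poweR_EFin !lee_fin => y0.
  by rewrite ler_root2// gmean_ge0.
Qed.
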